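(* Let $H$ be a finite dimensional semisimple and cosemisimple Hopf algebra over a field $k$, let $A=\bigoplus_{n\ge0}A_n$ be a graded right $H$-comodule algebra such that $A_i$ is finite dimensional for all $i\ge0$, and let $B=A^{coH}$. Assume that $A/B$ is an $H$-Galois graded extension. If $B$ is an $N$-Koszul algebra (where $N\ge 2$ is an integer), then $A$ is an $N$-Koszul algebra.
   Context: All algebras and modules are over a fixed field $k$, $\otimes=\otimes_k$. A graded right $H$-comodule algebra is a graded algebra $A$ that is a right $H$-comodule algebra whose coaction $\rho(a)=\sum a_{(0)}\otimes a_{(1)}$ satisfies $\rho(A_n)\subseteq A_n\otimes H$ for all $n$. Its coinvariant subalgebra $B=A^{coH}=\{a:\rho(a)=a\otimes1\}$ is a graded subalgebra, and $A/B$ is an $H$-Galois graded extension if the canonical map $A\otimes_BA\to A\otimes H$, $a\otimes a'\mapsto\sum aa'_{(0)}\otimes a'_{(1)}$, is bijective. $N$-Koszul algebras: let $A=\bigoplus_{n\ge0}A_n$ be a graded algebra such that each $A_i$ is finite dimensional, $A_0$ is semisimple and $A_iA_j=A_{i+j}$ for all $i,j\ge0$. Let $N\ge2$ be an integer. A graded $A$-module $M$ is an $N$-Koszul module if it has a graded projective resolution $\cdots\to P^{-n}\to\cdots\to P^{-1}\to P^0\to M\to0$ such that the graded projective module $P^{-n}$ ($n>0$) is generated in degree $\frac n2N$ if $n$ is even, and in degree $\frac{n-1}2N+1$ if $n$ is odd. If the trivial graded right $A$-module $A_0$ (a module via the projection $A\to A_0$) is $N$-Koszul, then $A$ is called an $N$-Koszul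 algebra. (Thus being an $N$-Koszul algebra includes the conditions of finite dimensional components, semisimple degree-zero part, and $A_iA_j=A_{i+j}$.) *)

(* Defs.v *)
From HB Require Import structures.
From mathcomp Require Import all_boot all_order all_algebra all_field.
From mathcomp Require Import generic_quotient boolp.

Set Implicit Arguments.
Unset Strict Implicit.
Unset Printing Implicit Defensive.

Import GRing.Theory.
Local Open Scope ring_scope.
Local Open Scope quotient_scope.

Section Tensor.

Variables (R : Type) (M N : zmodType).
Variables (ract : M -> R -> M) (lact : R -> N -> N).

Definition balanced (G : zmodType) (f : M -> N -> G) : Prop :=
  [/\ forall m m' n, f (m + m') n = f m n + f m' n,
      forall m n n', f m (n + n') = f m n + f m n'
    & forall m r n, f (ract m r) n = f m (lact r n)].

Definition formal_eval (G : zmodType) (f : M -> N -> G) (s : seq (M * N)) : G :=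
  \sum_(p <- s) f p.1 p.2.

(* Formal sums of pairs are identified when no balanced map separates them.   *)
(* The quotient has the universal property of the tensor product of M and N   *)
(* over R: see tens_balanced, tlift_tens and tlift_uniq. The actions are      *)
(* explicit functions because a library type carries only one module          *)
(* structure, and always a left one.                                          *)
Definition formal_eq (s t : seq (M * N)) : bool :=
  `[< forall (G : zmodType) (f : M -> N -> G),
        balanced f -> formal_eval f s = formal_eval f t >].

Lemma formal_eq_refl : reflexive formal_eq.
Proof. by move=> s; apply/asboolP. Qed.

Lemma formal_eq_sym : symmetric formal_eq.
Proof. by move=> s t; apply/asboolP/asboolP => h G f /h. Qed.

Lemma formal_eq_trans : transitive formal_eq.
Proof.
move=> t s u /asboolP st /asboolP tu; apply/asboolP => G f bf.
by rewrite st // tu.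
Qed.

Canonical formal_equiv :=
  EquivRel formal_eq formal_eq_refl formal_eq_sym formal_eq_trans.

Definition tensor : Type := {eq_quot formal_eq}.

HB.instance Definition _ : EqQuotient _ formal_eq tensor :=
  EqQuotient.on tensor.
HB.instance Definition _ := Choice.on tensor.

Definition tens (m : M) (n : N) : tensor := \pi_tensor [:: (m, n)].

(* When f is balanced, this is the induced map on the tensor product (and it  *)
(* is meaningless otherwise); tlift f (comul h) is then the sum of the        *)
(* f h_(1) h_(2) of Sweedler's notation.                                      *)
Definition tlift (G : zmodType) (f : M -> N -> G) (t : tensor) : G :=
  formal_eval f (repr t).

Lemma tlift_pi (G : zmodType) (f : M -> N -> G) (s : seq (M * N)) :
  balanced f -> tlift f (\pi_tensor s) = formal_eval f s.
Proof.
move=> bf; rewrite /tlift.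
have /eqmodP/asboolP -> // : repr (\pi_tensor s) = s %[mod tensor].
by rewrite reprK.
Qed.

Lemma tensorP (s t : seq (M * N)) :
  (forall (G : zmodType) (f : M -> N -> G),
     balanced f -> formal_eval f s = formal_eval f t) ->
  \pi_tensor s = \pi_tensor t.
Proof. by move=> h; apply/eqmodP/asboolP. Qed.

Lemma tensor_ext (x y : tensor) :
  (forall (G : zmodType) (f : M -> N -> G),
     balanced f -> tlift f x = tlift f y) -> x = y.
Proof. by move=> h; rewrite -[x]reprK -[y]reprK; apply: tensorP. Qed.

Definition tensor_zero : tensor := \pi_tensor [::].
Definition tensor_add (x y : tensor) : tensor :=
  \pi_tensor (repr x ++ repr y).
Definition tensor_opp (x : tensor) : tensor :=
  \pi_tensor [seq (- p.1, p.2) | p <- repr x].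

Section TliftAdd.
Variables (G : zmodType) (f : M -> N -> G).
Hypothesis bf : balanced f.

Lemma balanced0l n : f 0 n = 0.
Proof. by case: bf => fD _ _; apply: (addrI (f 0 n)); rewrite -fD !addr0. Qed.

Lemma balancedNl m n : f (- m) n = - f m n.
Proof.
case: bf => fD _ _; apply: (addrI (f m n)).
by rewrite -fD !subrr balanced0l.
Qed.

Lemma tlift_zero : tlift f tensor_zero = 0.
Proof. by rewrite tlift_pi // /formal_eval big_nil. Qed.

Lemma tlift_add x y : tlift f (tensor_add x y) = tlift f x + tlift f y.
Proof. by rewrite tlift_pi // /formal_eval big_cat. Qed.

Lemma tlift_opp x : tlift f (tensor_opp x) = - tlift f x.
Proof.
rewrite tlift_pi // /formal_eval big_map -sumrN.
by apply: eq_bigr => p _; rewrite balancedNl.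
Qed.

End TliftAdd.

Lemma tensor_addA : associative tensor_add.
Proof.
by move=> x y z; apply: tensor_ext => G f bf; rewrite !tlift_add // addrA.
Qed.

Lemma tensor_addC : commutative tensor_add.
Proof.
by move=> x y; apply: tensor_ext => G f bf; rewrite !tlift_add // addrC.
Qed.

Lemma tensor_add0 : left_id tensor_zero tensor_add.
Proof.
move=> x; apply: tensor_ext => G f bf.
by rewrite tlift_add // tlift_zero // add0r.
Qed.

Lemma tensor_addN : left_inverse tensor_zero tensor_opp tensor_add.
Proof.
move=> x; apply: tensor_ext => G f bf.
by rewrite tlift_add // tlift_opp // tlift_zero // addNr.
Qed.

HB.instance Definition _ := GRing.isZmodule.Build tensor
  tensor_addA tensor_addC tensor_add0 tensor_addN.

Lemma tliftD (G : zmodType) (f : M -> N -> G) :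
  balanced f -> {morph tlift f : x y / x + y}.
Proof. by move=> bf x y; apply: tlift_add. Qed.

Lemma tlift0 (G : zmodType) (f : M -> N -> G) : balanced f -> tlift f 0 = 0.
Proof. exact: tlift_zero. Qed.

Lemma tlift_sum (G : zmodType) (f : M -> N -> G) (I : Type) (r : seq I) F :
  balanced f -> tlift f (\sum_(i <- r) F i) = \sum_(i <- r) tlift f (F i).
Proof. by move=> bf; apply: big_morph; [exact: tliftD | exact: tlift0]. Qed.

Lemma tlift_tens (G : zmodType) (f : M -> N -> G) m n :
  balanced f -> tlift f (tens m n) = f m n.
Proof. by move=> bf; rewrite tlift_pi // /formal_eval big_seq1. Qed.

Lemma tens_balanced : balanced tens.
Proof.
split=> *; apply: tensor_ext => G f bf; case: (bf) => h1 h2 h3;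
  by rewrite ?tliftD // !tlift_tens.
Qed.

Lemma tensor_gen (x : tensor) : x = \sum_(p <- repr x) tens p.1 p.2.
Proof.
apply: tensor_ext => G f bf; rewrite tlift_sum //.
by apply: eq_bigr => p _; rewrite tlift_tens.
Qed.

Lemma tlift_uniq (G : zmodType) (f : M -> N -> G) (g : {additive tensor -> G}) :
  (forall m n, g (tens m n) = f m n) -> g =1 tlift f.
Proof.
move=> gf x; rewrite {1}[x]tensor_gen raddf_sum.
by apply: eq_bigr => p _; rewrite gf.
Qed.

(* x belongs to the image of the tensor product of the submodules P and Q *)
Definition in_tens (P : {pred M}) (Q : {pred N}) (x : tensor) : Prop :=
  exists2 s : seq (M * N),
    all (fun p => (p.1 \in P) && (p.2 \in Q)) s
    & x = \sum_(p <- s) tens p.1 p.2.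

End Tensor.

Section LinearTensor.

Variable k : fieldType.

Definition ktensor (M N : lmodType k) : Type :=
  @tensor k M N (fun m c => c *: m) (fun c n => c *: n).

Definition kbalanced (M N : lmodType k) (G : zmodType) (f : M -> N -> G) :=
  @balanced k M N (fun m c => c *: m) (fun c n => c *: n) G f.

Variables M N : lmodType k.

HB.instance Definition _ := GRing.Zmodule.on (ktensor M N).

Definition ktens (m : M) (n : N) : ktensor M N := tens _ _ m n.

Definition ktensor_scale (c : k) : ktensor M N -> ktensor M N :=
  tlift (fun m n => ktens (c *: m) n).

Lemma ktens_balanced : kbalanced ktens.
Proof. exact: tens_balanced. Qed.

Lemma ktensor_scale_balanced c : kbalanced (fun m n => ktens (c *: m) n).
Proof.
case: ktens_balanced => h1 h2 h3; split=> [m m' n|m n n'|m a n].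
- by rewrite scalerDr h1.
- by rewrite h2.
- by rewrite -h3 !scalerA mulrC.
Qed.

Lemma ktensor_scale_tens c m n :
  ktensor_scale c (ktens m n) = ktens (c *: m) n.
Proof. exact/tlift_tens/ktensor_scale_balanced. Qed.

Lemma ktensor_scaleD c : {morph ktensor_scale c : x y / x + y}.
Proof. exact/tliftD/ktensor_scale_balanced. Qed.

Lemma ktensor_gen (x : ktensor M N) :
  exists s : seq (M * N), x = \sum_(p <- s) ktens p.1 p.2.
Proof. by exists (repr x); apply: tensor_gen. Qed.

Lemma ktensor_ind (P : ktensor M N -> Prop) :
  P 0 -> (forall x y, P x -> P y -> P (x + y)) ->
  (forall m n, P (ktens m n)) -> forall x, P x.
Proof.
move=> P0 PD Pt x; have [s ->] := ktensor_gen x.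
by elim/big_ind: _ => // p _; apply: Pt.
Qed.

Lemma ktensor_scale0 c : ktensor_scale c 0 = 0.
Proof. exact/tlift0/ktensor_scale_balanced. Qed.

Lemma ktensor_scaleA a b x :
  ktensor_scale a (ktensor_scale b x) = ktensor_scale (a * b) x.
Proof.
elim/ktensor_ind: x => [|x y hx hy|m n]; first by rewrite !ktensor_scale0.
  by rewrite !ktensor_scaleD hx hy.
by rewrite !ktensor_scale_tens scalerA.
Qed.

Lemma ktensor_scale1 : left_id 1 ktensor_scale.
Proof.
elim/ktensor_ind=> [|x y hx hy|m n]; first by rewrite ktensor_scale0.
  by rewrite ktensor_scaleD hx hy.
by rewrite ktensor_scale_tens scale1r.
Qed.

Lemma ktensor_scaleDr : right_distributive ktensor_scale +%R.
Proof. by move=> c x y; apply: ktensor_scaleD. Qed.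

Lemma ktensor_scaleDl x : {morph ktensor_scale^~ x : a b / a + b}.
Proof.
move=> a b; elim/ktensor_ind: x => [|x y hx hy|m n].
- by rewrite !ktensor_scale0 addr0.
- by rewrite !ktensor_scaleD hx hy addrACA.
by rewrite !ktensor_scale_tens scalerDl; case: ktens_balanced => ->.
Qed.

HB.instance Definition _ := GRing.Zmodule_isLmodule.Build k (ktensor M N)
  ktensor_scaleA ktensor_scale1 ktensor_scaleDr ktensor_scaleDl.

Lemma ktensZl c m n : c *: ktens m n = ktens (c *: m) n.
Proof. exact: ktensor_scale_tens. Qed.

Lemma ktensZr c m n : c *: ktens m n = ktens m (c *: n).
Proof. by case: ktens_balanced => _ _ h; rewrite ktensZl; apply: h. Qed.

Lemma klift_balanced (G : lmodType k) (f : M -> N -> G) :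
  (forall n, linear (f^~ n)) -> (forall m, linear (f m)) -> kbalanced f.
Proof.
move=> fl fr.
have l1 m m' n : f (m + m') n = f m n + f m' n.
  by have := fl n 1 m m'; rewrite !scale1r.
have r1 m n n' : f m (n + n') = f m n + f m n'.
  by have := fr m 1 n n'; rewrite !scale1r.
split=> // m c n.
have l0 : f 0 n = 0 by apply: (addrI (f 0 n)); rewrite -l1 !addr0.
have r0 : f m 0 = 0 by apply: (addrI (f m 0)); rewrite -r1 !addr0.
by have := fl n c m 0; have := fr m c n 0; rewrite !addr0 l0 r0 !addr0 => -> ->.
Qed.

Lemma klift_linear (G : lmodType k) (f : M -> N -> G) :
  (forall n, linear (f^~ n)) -> (forall m, linear (f m)) ->
  linear (tlift f : ktensor M N -> G).
Proof.
move=> fl fr; have bf := klift_balanced fl fr.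
have lD := tliftD bf; have l0 := tlift0 bf.
move=> c x y; rewrite lD; congr (_ + _); elim/ktensor_ind: x => [|x x' hx hx'|m n].
- by rewrite scaler0 l0 scaler0.
- by rewrite scalerDr !lD hx hx' scalerDr.
rewrite ktensZl !tlift_tens //.
by have := fl n c m 0; rewrite !addr0 (balanced0l bf) addr0.
Qed.

End LinearTensor.

Arguments ktens {k M N} m n.
Notation "M ⊗ N" := (ktensor M N) (at level 40, left associativity) : type_scope.
Notation "m ⊗ n" := (ktens m n) (at level 40, left associativity) : ring_scope.

Definition tmul (k : fieldType) (A C : algType k) (x y : A ⊗ C) : A ⊗ C :=
  tlift (fun a c => tlift (fun a' c' => (a * a') ⊗ (c * c')) y) x.

Definition semisimple_module (R : pzRingType) (M : lmodType R) : Prop :=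
  forall U : {pred M}, submod_closed U ->
  exists W : {pred M}, [/\ submod_closed W,
    forall m, exists u w, [/\ u \in U, w \in W & m = u + w]
  & forall m, m \in U -> m \in W -> m = 0].

(* A right R-module is encoded as a left module over the converse ring R^c;   *)
(* thus (R^c)^o is the right regular module.                                  *)
Definition semisimple_ring (R : nzRingType) : Prop :=
  semisimple_module ((R^c)^o : lmodType R^c).

Record hopf_algebra (k : fieldType) (H : algType k) := HopfAlgebra {
  comul : {linear H -> (H ⊗ H)%type};
  counit : {lrmorphism H -> k^o};
  antipode : {linear H -> H};
  comulA : forall h,
    tlift (fun x y => tlift (fun x1 x2 => x1 ⊗ (x2 ⊗ y)) (comul x)) (comul h)
    = tlift (fun x y => x ⊗ comul y) (comul h);
  counitl : forall h, tlift (fun x y => (counit x : k) *: y) (comul h) = h;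
  counitr : forall h, tlift (fun x y => (counit y : k) *: x) (comul h) = h;
  comul1 : comul 1 = 1 ⊗ 1;
  comulM : forall g h, comul (g * h) = tmul (comul g) (comul h);
  antipodel : forall h,
    tlift (fun x y => antipode x * y) (comul h) = (counit h : k)%:A;
  antipoder : forall h,
    tlift (fun x y => x * antipode y) (comul h) = (counit h : k)%:A
}.

Section Cosemisimple.

Variables (k : fieldType) (H : falgType k) (HH : hopf_algebra H).

Definition subcoalgebra (D : {vspace H}) : Prop :=
  forall h, h \in D -> in_tens (mem D) (mem D) (comul HH h).

Definition simple_subcoalgebra (D : {vspace H}) : Prop :=
  [/\ subcoalgebra D, D != 0%VS
    & forall E : {vspace H}, subcoalgebra E -> (E <= D)%VS ->
        E = 0%VS \/ E = D].

Definition cosemisimple : Prop :=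
  exists (n : nat) (D : 'I_n -> {vspace H}),
    [/\ forall i, simple_subcoalgebra (D i),
        directv (\sum_i D i)
      & (\sum_i D i)%VS = fullv].

End Cosemisimple.

Section Grading.

(* A direct sum decomposition of V indexed by I is given by the projections   *)
(* p i onto its components, the component of index i being the image of p i.  *)

Variables (I : eqType) (V : zmodType) (p : I -> V -> V).

Definition homog (i : I) : {pred V} := [pred v | p i v == v].

Definition is_decomposition : Prop :=
  (forall i j v, p i (p j v) = if i == j then p j v else 0)
  /\ (forall v, exists2 s : seq I, uniq s & v = \sum_(i <- s) p i v).

End Grading.

Record graded_algebra (k : fieldType) (A : algType k) := GradedAlgebra {
  acomp :> nat -> {linear A -> A};
  acomp_decomp : is_decomposition acomp;
  acomp_one : 1 \in homog acomp 0%N;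
  acomp_mul : forall i j a b, a \in homog acomp i -> b \in homog acomp j ->
    a * b \in homog acomp (i + j)%N
}.

Definition in_deg (k : fieldType) (A : algType k) (gA : graded_algebra A)
  (n : nat) : {pred A} := homog (acomp gA) n.

Section GradedModules.

Variables (k : fieldType) (A : algType k) (gA : graded_algebra A).

(* Right A-modules, as left modules over A^c: (a : A^c) *: m stands for m a.  *)
(* The scalars of k act through c%:A.                                         *)
Record graded_module := GradedModule {
  gmod :> lmodType A^c;
  mcomp : int -> {additive gmod -> gmod};
  mcomp_decomp : is_decomposition mcomp;
  mcomp_act : forall (i : int) (j : nat) (m : gmod) (a : A),
    m \in homog mcomp i -> a \in in_deg gA j ->
    (a : A^c) *: m \in homog mcomp (i + j%:Z)
}.

Definition in_mdeg (M : graded_module) (i : int) : {pred M} :=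
  homog (@mcomp M) i.
Arguments in_mdeg : clear implicits.

Definition graded_hom (M N : graded_module) (f : {linear M -> N}) : Prop :=
  forall i m, m \in in_mdeg M i -> f m \in in_mdeg N i.

Definition graded_projective (P : graded_module) : Prop :=
  forall (M N : graded_module) (g : {linear M -> N}) (f : {linear P -> N}),
    graded_hom g -> (forall y, exists x, g x = y) -> graded_hom f ->
    exists2 h : {linear P -> M}, graded_hom h & forall x, g (h x) = f x.

Definition generated_in_degree (M : graded_module) (d : int) : Prop :=
  forall m : M, exists2 s : seq (M * A),
    all (fun p => p.1 \in in_mdeg M d) s
    & m = \sum_(p <- s) (p.2 : A^c) *: p.1.

(* The degree in which the n-th term of an N-Koszul resolution is generated *)
Definition koszul_degree (N n : nat) : nat :=
  (if odd n then (n.-1)./2 * N + 1 else n./2 * N)%N.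

Definition N_koszul_module (N : nat) (M : graded_module) : Prop :=
  exists (P : nat -> graded_module)
         (d : forall n, {linear P n.+1 -> P n}) (e : {linear P 0%N -> M}),
  [/\ (forall n, graded_projective (P n)),
      (forall n, graded_hom (d n)) /\ graded_hom e,
      forall y, exists x, e x = y,
      (forall x, e x = 0 <-> exists y, d 0%N y = x)
        /\ (forall n x, d n x = 0 <-> exists y, d n.+1 y = x)
    & forall n, (0 < n)%N ->
        generated_in_degree (P n) (koszul_degree N n)%:Z].

End GradedModules.

Arguments in_mdeg {k A gA} M i _.

Section Subalgebra.

Variables (k : fieldType) (A : algType k) (S : subalgClosed A).

Record subalgebra := Subalgebra { subalg_val : A; _ : subalg_val \in S }.

HB.instance Definition _ := [isSub for subalg_val].
HB.instance Definition _ := [Choice of subalgebra by <:].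
HB.instance Definition _ := [SubChoice_isSubAlgebra of subalgebra by <:].

End Subalgebra.

Section DegreeZero.

Variables (k : fieldType) (A : algType k) (gA : graded_algebra A).

Lemma homogP i a : reflect (gA i a = a) (a \in in_deg gA i).
Proof. exact: eqP. Qed.

Lemma acomp_homog i a : gA i a \in in_deg gA i.
Proof. by apply/homogP; case: (acomp_decomp gA) => ->; rewrite eqxx. Qed.

Lemma acomp_other i j a : a \in in_deg gA j -> i != j -> gA i a = 0.
Proof.
move=> /homogP <- /negPf ij.
by case: (acomp_decomp gA) => ->; rewrite ij.
Qed.

Lemma acomp0M a b : gA 0%N (a * b) = gA 0%N a * gA 0%N b.
Proof.
case: (acomp_decomp gA) => _ dec; have [s _ ->] := dec a; have [t _ ->] := dec b.
rewrite mulr_suml !linear_sum mulr_suml; apply: eq_bigr => i _.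
rewrite mulr_sumr !linear_sum mulr_sumr; apply: eq_bigr => j _.
have hij := acomp_mul (acomp_homog i a) (acomp_homog j b).
have [ij0|ij0] := eqVneq (i + j)%N 0%N.
  move/eqP: ij0 hij; rewrite addn_eq0 => /andP[/eqP -> /eqP ->].
  rewrite addn0 => /homogP ->.
  by have /homogP -> := acomp_homog 0 a; have /homogP -> := acomp_homog 0 b.
rewrite (acomp_other hij); last by rewrite eq_sym.
case: i {hij} ij0 => [|i] ij0; last by rewrite [X in X * _](acomp_other (acomp_homog _ a)) ?mul0r.
by rewrite [X in _ * X](acomp_other (acomp_homog _ b)) ?mulr0 // eq_sym.
Qed.

Definition deg0_pred : A -> bool := fun a => a \in in_deg gA 0%N.

Lemma deg0_subalg : subalg_closed deg0_pred.
Proof.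
split=> [|c a b|a b]; first exact: acomp_one.
  move=> /homogP ha /homogP hb; apply/homogP.
  by rewrite linearP /= ha hb.
exact: (@acomp_mul _ _ gA 0%N 0).
Qed.

Definition deg0 : subalgClosed A := HB.pack_for (subalgClosed A) deg0_pred
  (GRing.isSubalgClosed.Build k A deg0_pred deg0_subalg).

Definition degree_zero : algType k := subalgebra deg0.

(* The abelian group A_0 with the right A-module structure obtained through   *)
(* the projection of A onto A_0                                               *)
Definition trivial_carrier : Type := subalgebra deg0.

HB.instance Definition _ := GRing.Zmodule.on trivial_carrier.

Lemma trivial_act_subproof (a : A) (x : subalgebra deg0) :
  val x * gA 0%N a \in deg0.
Proof. exact: (@acomp_mul _ _ gA 0%N 0%N _ _ (valP x) (acomp_homog 0 a)). Qed.

Definition trivial_act (a : A^c) (x : trivial_carrier) : trivial_carrier :=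
  Subalgebra (trivial_act_subproof a x).

Lemma trivial_actA (a b : A^c) x :
  trivial_act a (trivial_act b x) = trivial_act (a * b) x.
Proof. by apply: val_inj; rewrite /= [gA 0%N (a * b)]acomp0M mulrA. Qed.

Lemma trivial_act1 : left_id 1 trivial_act.
Proof.
by move=> x; apply: val_inj; rewrite /= (homogP _ _ (acomp_one gA)) mulr1.
Qed.

Lemma trivial_actDr : right_distributive trivial_act +%R.
Proof. by move=> a x y; apply: val_inj; rewrite /= mulrDl. Qed.

Lemma trivial_actDl x : {morph trivial_act^~ x : a b / a + b}.
Proof. by move=> a b; apply: val_inj; rewrite /= raddfD mulrDr. Qed.

HB.instance Definition _ := GRing.Zmodule_isLmodule.Build A^c trivial_carrier
  trivial_actA trivial_act1 trivial_actDr trivial_actDl.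

Definition trivial_comp (i : int) (x : trivial_carrier) : trivial_carrier :=
  if i == 0 then x else 0.

Lemma trivial_comp_additive i : zmod_morphism (trivial_comp i).
Proof. by move=> x y; rewrite /trivial_comp; case: eqP; rewrite ?subr0. Qed.

HB.instance Definition _ i := GRing.isZmodMorphism.Build
  trivial_carrier trivial_carrier (trivial_comp i) (trivial_comp_additive i).

Lemma trivial_decomp : is_decomposition trivial_comp.
Proof.
split=> [i j v|v].
  rewrite /trivial_comp; case: (eqVneq i j) => [->|ij]; first by case: eqP.
  by case: eqP => // i0; case: eqP => // j0; rewrite i0 j0 eqxx in ij.
by exists [:: 0] => //; rewrite big_seq1.
Qed.

Lemma trivial_comp_act (i : int) (j : nat) (m : trivial_carrier) (a : A) :
  m \in homog trivial_comp i -> a \in in_deg gA j ->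
  (a : A^c) *: m \in homog trivial_comp (i + j%:Z).
Proof.
rewrite !inE /trivial_comp.
have [-> _ | ni /eqP <- _] := eqVneq i 0; last first.
  by rewrite scaler0; case: ifP.
case: j => [_|j /acomp_other h]; first by rewrite addr0 eqxx.
rewrite (_ : _ *: _ = 0) ?if_same //.
by apply: val_inj; rewrite /= h ?mulr0.
Qed.

Definition trivial_module : graded_module gA :=
  @GradedModule _ _ gA trivial_carrier trivial_comp trivial_decomp
    trivial_comp_act.

Definition finite_dim_component (i : nat) : Prop :=
  exists (n : nat) (e : 'I_n -> A),
    (forall l, e l \in in_deg gA i) /\
    (forall a, a \in in_deg gA i -> exists c : 'I_n -> k, a = \sum_l c l *: e l).

Definition N_koszul_algebra (N : nat) : Prop :=
  [/\ forall i, finite_dim_component i,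
      semisimple_ring degree_zero,
      forall i j a, a \in in_deg gA (i + j)%N ->
        exists2 s : seq (A * A),
          all (fun p => (p.1 \in in_deg gA i) && (p.2 \in in_deg gA j)) s
          & a = \sum_(p <- s) p.1 * p.2
    & N_koszul_module N trivial_module].

End DegreeZero.

Section ComoduleAlgebra.

Variables (k : fieldType) (H : algType k) (HH : hopf_algebra H).
Variables (A : algType k) (gA : graded_algebra A).

Record graded_comodule_algebra := GradedComoduleAlgebra {
  coact :> {linear A -> (A ⊗ H)%type};
  coactA : forall a,
    tlift (fun x h => tlift (fun x0 x1 => x0 ⊗ (x1 ⊗ h)) (coact x)) (coact a)
    = tlift (fun x h => x ⊗ comul HH h) (coact a);
  coact_counit : forall a,
    tlift (fun x h => (counit HH h : k) *: x) (coact a) = a;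
  coact1 : coact 1 = 1 ⊗ 1;
  coactM : forall a b, coact (a * b) = tmul (coact a) (coact b);
  coact_graded : forall n a, a \in in_deg gA n ->
    in_tens (in_deg gA n) predT (coact a)
}.

Lemma tmul_inner_balanced (a : A) (h : H) :
  kbalanced (fun a' h' => (a * a') ⊗ (h * h')).
Proof.
apply: klift_balanced => [h' c x y|a' c x y].
  case: (ktens_balanced A H) => tl _ _.
  by rewrite mulrDr tl -scalerAr ktensZl.
case: (ktens_balanced A H) => _ tr _.
by rewrite mulrDr tr -scalerAr ktensZr.
Qed.

Lemma tmul_outer_balanced (y : A ⊗ H) :
  kbalanced (fun a h => tlift (fun a' h' => (a * a') ⊗ (h * h')) y).
Proof.
case: (ktens_balanced A H) => tl tr tb.
split=> [a a' h|a h h'|a c h]; rewrite /tlift /formal_eval -?big_split /=;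
  apply: eq_bigr => p _.
- by rewrite mulrDl tl.
- by rewrite mulrDl tr.
- by rewrite -!scalerAl tb.
Qed.

Lemma tmul_tens (a a' : A) (h h' : H) :
  tmul (a ⊗ h) (a' ⊗ h') = (a * a') ⊗ (h * h').
Proof.
rewrite /tmul tlift_tens; last exact: tmul_outer_balanced.
by rewrite tlift_tens //; apply: tmul_inner_balanced.
Qed.

Variable rho : graded_comodule_algebra.

Definition coinv_pred : A -> bool := fun a => rho a == a ⊗ 1.

Lemma coinv_subalg : subalg_closed coinv_pred.
Proof.
case: (ktens_balanced A H) => tl _ _.
split=> [|c a b|a b]; first by apply/eqP; rewrite coact1.
  by move=> /eqP ha /eqP hb; apply/eqP; rewrite linearP /= ha hb ktensZl -tl.
by move=> /eqP ha /eqP hb; apply/eqP; rewrite coactM ha hb tmul_tens mulr1.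
Qed.

Definition coinv : subalgClosed A := HB.pack_for (subalgClosed A) coinv_pred
  (GRing.isSubalgClosed.Build k A coinv_pred coinv_subalg).

Definition coinvariants : algType k := subalgebra coinv.

Lemma coact_comp n a :
  rho (gA n a) = tlift (fun x h => gA n x ⊗ h) (rho a).
Proof.
have bal : kbalanced (fun x h => gA n x ⊗ h : A ⊗ H).
  case: (ktens_balanced A H) => tl tr tb.
  by split=> *; rewrite ?linearD ?linearZ ?tl ?tr ?tb.
have hom m b : b \in in_deg gA m ->
    rho (gA n b) = tlift (fun x h => gA n x ⊗ h) (rho b).
  move=> hb; have [s /allP hs rb] := coact_graded rho hb.
  have [nm|nm] := eqVneq n m.
    rewrite nm (homogP _ _ _ hb) rb -nm tlift_sum //.
    rewrite big_seq [RHS]big_seq; apply: eq_bigr => p /hs /andP[hp _].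
    by rewrite tlift_tens // nm (homogP _ _ _ hp).
  rewrite (acomp_other hb nm) linear0 rb tlift_sum // big_seq big1 // => p.
  move=> /hs /andP[hp _]; rewrite tlift_tens // (acomp_other hp nm).
  exact: (balanced0l (ktens_balanced A H)).
case: (acomp_decomp gA) => _ /(_ a) [s _ ->].
rewrite !linear_sum tlift_sum //; apply: eq_bigr => i _.
by apply/hom/acomp_homog.
Qed.

Lemma coinv_comp_subproof n (b : subalgebra coinv) : gA n (val b) \in coinv.
Proof.
have /eqP hb := valP b; apply/eqP; rewrite coact_comp hb tlift_tens //.
case: (ktens_balanced A H) => tl tr tb.
by split=> *; rewrite ?linearD ?linearZ ?tl ?tr ?tb.
Qed.

Definition coinv_comp (n : nat) (b : coinvariants) : coinvariants :=
  Subalgebra (coinv_comp_subproof n b).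

Lemma coinv_comp_linear n : linear (coinv_comp n).
Proof. by move=> c x y; apply: val_inj; rewrite /= linearP. Qed.

HB.instance Definition _ n := GRing.isLinear.Build k coinvariants coinvariants
  _ (coinv_comp n) (coinv_comp_linear n).

Lemma coinv_homog n (b : coinvariants) :
  (b \in homog coinv_comp n) = (val b \in in_deg gA n).
Proof. by rewrite !inE -val_eqE. Qed.

Lemma coinv_decomp : is_decomposition coinv_comp.
Proof.
case: (acomp_decomp gA) => orth dec; split=> [i j b|b].
  by apply: val_inj; rewrite /= orth; case: eqP.
have [s us hs] := dec (val b); exists s => //.
by apply: val_inj; rewrite raddf_sum.
Qed.

Lemma coinv_one : 1 \in homog coinv_comp 0%N.
Proof. by rewrite coinv_homog; apply: acomp_one. Qed.

Lemma coinv_mul i j (a b : coinvariants) :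
  a \in homog coinv_comp i -> b \in homog coinv_comp j ->
  a * b \in homog coinv_comp (i + j)%N.
Proof. by rewrite !coinv_homog; apply: acomp_mul. Qed.

Definition coinv_graded : graded_algebra coinvariants :=
  @GradedAlgebra k coinvariants coinv_comp coinv_decomp coinv_one coinv_mul.

(* The tensor product of A with itself over the subalgebra of coinvariants *)
Definition galois_source : Type :=
  @tensor coinvariants A A (fun a b => a * val b) (fun b a => val b * a).

HB.instance Definition _ := GRing.Zmodule.on galois_source.

Definition canonical_map : galois_source -> A ⊗ H :=
  tlift (fun a a' => tlift (fun a0 a1 => (a * a0) ⊗ a1) (rho a')).

Lemma canonical_map_balanced :
  @balanced coinvariants A A (fun a b => a * val b) (fun b a => val b * a) _
    (fun a a' => tlift (fun a0 a1 => (a * a0) ⊗ a1) (rho a')).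
Proof.
have bal a : kbalanced (fun a0 a1 => (a * a0) ⊗ a1 : A ⊗ H).
  apply: klift_balanced => [h c x y|x c h h']; case: (ktens_balanced A H) => tl tr _.
    by rewrite mulrDr tl -scalerAr ktensZl.
  by rewrite tr ktensZr.
case: (ktens_balanced A H) => tl _ _.
split=> [a a' b|a b b'|a b a'].
- by rewrite /tlift /formal_eval -big_split; apply: eq_bigr => p _; rewrite mulrDl tl.
- by rewrite linearD (tliftD (bal a)).
rewrite coactM; have /eqP -> := valP b.
rewrite /tmul tlift_tens; last exact: tmul_outer_balanced.
rewrite {1 3}/tlift /formal_eval (tlift_sum _ _ (bal a)); apply: eq_bigr => p _.
by rewrite (tlift_tens _ _ (bal a)) mul1r mulrA.
Qed.

Lemma canonical_map_tens a a' :
  canonical_map (tens _ _ a a')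
  = tlift (fun a0 a1 => (a * a0) ⊗ a1) (rho a').
Proof. exact/tlift_tens/canonical_map_balanced. Qed.

Definition galois_graded_extension : Prop := bijective canonical_map.

End ComoduleAlgebra.

(* Main.v *)
Require Import Defs.
From HB Require Import structures.
From mathcomp Require Import all_boot all_order all_algebra all_field.
From mathcomp Require Import boolp.

(* With la in H^* an integral normalised by la(1) = 1 (it exists because k1 is
   one of the simple summands of H), E(a) = a_(0) la(a_(1)) is a B-bilinear
   projection of A onto B. Writing can^-1(1 ⊗ h) as a sum of l(h) ⊗ r(h) with
   l(h), r(h) in A_0, one gets a = E(a_(0) l(a_(1))) r(a_(1)): A is a finitely
   generated projective left B-module, with a homogeneous dual basis f_j, r_j
   whose elements r_j have degree 0. Hence A_n = B_n A_0, and P |-> P ⊗_B A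
   sends the Koszul resolution of B_0 to a Koszul resolution of B_0 ⊗_B A = A_0.
   With t in H an integral normalised by eps(t) = 1, can^-1(1 ⊗ t) is a Casimir
   element of A_0 over B_0, and averaging with it turns a B_0-linear projection
   of A_0 onto a right ideal into an A_0-linear one, so A_0 is semisimple. *)

Set Implicit Arguments.
Unset Strict Implicit.
Unset Printing Implicit Defensive.

Import GRing.Theory.
Local Open Scope ring_scope.

(** * Tensor products and graded modules *)

Section TensorGeneral.
Variables (R : Type) (M N : zmodType).
Variables (ract : M -> R -> M) (lact : R -> N -> N).
Local Notation T := (tensor ract lact).

Lemma tensor_ind (P : T -> Prop) :
  P 0 -> (forall x y, P x -> P y -> P (x + y)) ->
  (forall m n, P (tens ract lact m n)) -> forall x, P x.
Proof.
move=> P0 PD Pt x; rewrite [x]tensor_gen.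
by elim/big_ind: _ => // p _; apply: Pt.
Qed.

Lemma tensDl m m' n :
  tens ract lact (m + m') n = tens ract lact m n + tens ract lact m' n.
Proof. by case: (tens_balanced ract lact) => h _ _; apply: h. Qed.

Lemma tensDr m n n' :
  tens ract lact m (n + n') = tens ract lact m n + tens ract lact m n'.
Proof. by case: (tens_balanced ract lact) => _ h _; apply: h. Qed.

Lemma tens_mid m r n :
  tens ract lact (ract m r) n = tens ract lact m (lact r n).
Proof. by case: (tens_balanced ract lact) => _ _ h; apply: h. Qed.

Lemma tens0l n : tens ract lact 0 n = 0.
Proof. exact: balanced0l (tens_balanced ract lact) n. Qed.

Lemma tens0r m : tens ract lact m 0 = 0.
Proof. by apply: (addrI (tens ract lact m 0)); rewrite -tensDr !addr0. Qed.

Lemma tens_suml (I : Type) (s : seq I) (F : I -> M) n :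
  tens ract lact (\sum_(i <- s) F i) n = \sum_(i <- s) tens ract lact (F i) n.
Proof.
by apply: (big_morph (fun m => tens _ _ m n)) => [m m'|];
  [exact: tensDl|exact: tens0l].
Qed.

Lemma tens_sumr (I : Type) (s : seq I) (F : I -> N) m :
  tens ract lact m (\sum_(i <- s) F i) = \sum_(i <- s) tens ract lact m (F i).
Proof.
by apply: (big_morph (tens _ _ m)) => [n n'|]; [exact: tensDr|exact: tens0r].
Qed.

End TensorGeneral.

Section Decomposition.
Variables (I : eqType) (V : zmodType) (p : I -> {additive V -> V}).
Hypothesis dec : is_decomposition p.

Lemma decomp_homog i v : p i v \in homog p i.
Proof. by case: dec => h _; rewrite inE h eqxx. Qed.

Lemma decomp_other i j v : v \in homog p j -> i != j -> p i v = 0.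
Proof. by case: dec => h _ /eqP <- /negPf ij; rewrite h ij. Qed.

(** By orthogonality, the expansion of v over [s] makes every component with index outside [s]
    vanish, so a longer list adds only zero terms. *)
Lemma decomp_superset (s t : seq I) v :
  uniq s -> uniq t -> {subset s <= t} ->
  v = \sum_(i <- s) p i v -> v = \sum_(i <- t) p i v.
Proof.
move=> us ut st vE.
have z i : i \notin s -> p i v = 0.
  move=> si; rewrite vE raddf_sum big_seq big1 // => j sj.
  by case: dec => -> _; case: eqP => // ij; rewrite ij sj in si.
rewrite (bigID (mem s)) /= [X in _ + X]big1; last by move=> i; apply: z.
rewrite addr0 -big_filter {1}vE; apply: perm_big; apply: uniq_perm => //.
  exact: filter_uniq.
move=> i; rewrite mem_filter; case si: (i \in s) => //=.
by rewrite (st i si).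
Qed.

Lemma decomp_family (J : finType) (v : J -> V) :
  exists2 s : seq I, uniq s & forall j, v j = \sum_(i <- s) p i (v j).
Proof.
have /fin_all_exists2[S uS vS] j :
    exists2 s : seq I, uniq s & v j = \sum_(i <- s) p i (v j).
  by case: dec => _; apply.
exists (undup (flatten [seq S j | j <- enum J])); first exact: undup_uniq.
move=> j; apply: decomp_superset (uS j) (undup_uniq _) _ (vS j) => i ij.
rewrite mem_undup; apply/flattenP; exists (S j) => //.
by apply: map_f; rewrite mem_enum.
Qed.

End Decomposition.

Section GradedModuleTheory.
Variables (k : fieldType) (A : algType k) (gA : graded_algebra A).
Variable M : graded_module gA.

Lemma in_mdegD i (x y : M) :
  x \in in_mdeg M i -> y \in in_mdeg M i -> x + y \in in_mdeg M i.
Proof. by rewrite !inE => /eqP hx /eqP hy; rewrite raddfD hx hy. Qed.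

Lemma in_mdeg0 i : 0 \in in_mdeg M i.
Proof. by rewrite inE raddf0. Qed.

Lemma in_mdeg_sum (J : Type) (s : seq J) (P : pred J) (F : J -> M) i :
  (forall j, P j -> F j \in in_mdeg M i) ->
  \sum_(j <- s | P j) F j \in in_mdeg M i.
Proof.
by move=> h; elim/big_ind: _ => //; [exact: in_mdeg0|exact: in_mdegD].
Qed.

Lemma mcomp_homog i (x : M) : mcomp M i x \in in_mdeg M i.
Proof. exact: (decomp_homog (mcomp_decomp M)). Qed.

Lemma act0_homog i (x : M) (a : A) :
  x \in in_mdeg M i -> a \in in_deg gA 0 -> (a : A^c) *: x \in in_mdeg M i.
Proof. by move=> hx ha; have := mcomp_act hx ha; rewrite addr0. Qed.

(** An element of degree 0 maps each homogeneous component of M into itself. *)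
Lemma mcomp_act0 i (x : M) (a : A) :
  a \in in_deg gA 0 -> mcomp M i ((a : A^c) *: x) = (a : A^c) *: mcomp M i x.
Proof.
move=> a0; have [orth dec] := mcomp_decomp M; have [s _ ->] := dec x.
rewrite (scaler_sumr (a : A^c)) !raddf_sum; apply: eq_bigr => j _.
have hj := act0_homog (mcomp_homog j x) a0.
rewrite orth; case: (eqVneq i j) => [->|ij]; first exact/eqP.
by rewrite raddf0; apply: (decomp_other (mcomp_decomp M) hj).
Qed.

End GradedModuleTheory.

(** * Restriction and induction of graded modules *)

Section Restriction.
Variables (k : fieldType) (A B : algType k) (inc : {rmorphism B -> A}).

Section Carrier.
Variable M : lmodType A^c.

(* The unused argument records the morphism, so that the action of B^c can be a
   canonical instance. *)
Definition restr_carrier (_ : {rmorphism B -> A}) : Type := M.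
Definition restr : Type := restr_carrier inc.
HB.instance Definition _ := GRing.Zmodule.copy restr M.

Definition restr_act (b : B^c) (m : restr) : restr := (inc b : A^c) *: (m : M).

Lemma restr_actA (b c : B^c) m :
  restr_act b (restr_act c m) = restr_act (b * c) m.
Proof. by rewrite /restr_act scalerA -[RHS]/(_ *: _) [inc (b * c)]rmorphM. Qed.

Lemma restr_act1 : left_id 1 restr_act.
Proof. by move=> m; rewrite /restr_act rmorph1 [LHS]scale1r. Qed.

Lemma restr_actDr : right_distributive restr_act +%R.
Proof. by move=> b x y; rewrite /restr_act [LHS]scalerDr. Qed.

Lemma restr_actDl x : {morph restr_act^~ x : b c / b + c}.
Proof. by move=> b c; rewrite /restr_act rmorphD [LHS]scalerDl. Qed.

HB.instance Definition _ := GRing.Zmodule_isLmodule.Build B^c restr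
  restr_actA restr_act1 restr_actDr restr_actDl.

Lemma restr_actE (b : B) (m : restr) :
  (b : B^c) *: m = ((inc b : A^c) *: (m : M) : M).
Proof. by []. Qed.

End Carrier.

Variables (gA : graded_algebra A) (gB : graded_algebra B).
Hypothesis inc_deg : forall n b, b \in in_deg gB n -> inc b \in in_deg gA n.
Variable M : graded_module gA.

Definition restr_comp (i : int) (m : restr M) : restr M := mcomp M i m.

Lemma restr_comp_additive i : zmod_morphism (restr_comp i).
Proof. by move=> x y; rewrite /restr_comp [LHS]raddfB. Qed.

HB.instance Definition _ i := GRing.isZmodMorphism.Build
  (restr M) (restr M) (restr_comp i) (restr_comp_additive i).

Lemma restr_decomp : is_decomposition restr_comp.
Proof. exact: (mcomp_decomp M). Qed.

Lemma restr_comp_act (i : int) (j : nat) (m : restr M) (b : B) :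
  m \in homog restr_comp i -> b \in in_deg gB j ->
  (b : B^c) *: m \in homog restr_comp (i + j%:Z).
Proof. by move=> hm hb; exact: (@mcomp_act _ _ _ M _ _ _ _ hm (inc_deg hb)). Qed.

Definition restr_module : graded_module gB :=
  @GradedModule _ _ gB (restr M) restr_comp restr_decomp restr_comp_act.

End Restriction.

(** * Extension of scalars and its adjunction with restriction *)

Section Induction.
Variables (k : fieldType) (A B : algType k) (inc : {rmorphism B -> A}).
Variable P : lmodType B^c.

(** This is P ⊗_B A, with A a left B-module through [inc]. *)
Definition induced : Type :=
  @tensor B P A (fun p b => (b : B^c) *: p) (fun b a => inc b * a).
HB.instance Definition _ := GRing.Zmodule.on induced.

Definition itens (p : P) (a : A) : induced := tens _ _ p a.

Lemma itensDl p q a : itens (p + q) a = itens p a + itens q a.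
Proof. exact: tensDl. Qed.

Lemma itensDr p a b : itens p (a + b) = itens p a + itens p b.
Proof. exact: tensDr. Qed.

Lemma itens_mid p b a : itens ((b : B^c) *: p) a = itens p (inc b * a).
Proof. exact: (tens_mid (fun p (b : B) => (b : B^c) *: p) (fun b a => inc b * a)). Qed.

Lemma induced_ind (Q : induced -> Prop) :
  Q 0 -> (forall x y, Q x -> Q y -> Q (x + y)) ->
  (forall p a, Q (itens p a)) -> forall x, Q x.
Proof. exact: tensor_ind. Qed.

Definition induced_act (a : A^c) : induced -> induced :=
  tlift (fun (p : P) (b : A) => itens p (b * (a : A) : A)).

Lemma induced_act_balanced (a : A) :
  @balanced B P A (fun p b => (b : B^c) *: p) (fun b a => inc b * a) _
    (fun p a' => itens p (a' * a)).
Proof.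
split=> [p q a'|p a' c|p b a']; first exact: itensDl.
  by rewrite mulrDl itensDr.
by rewrite itens_mid mulrA.
Qed.

Lemma induced_act_tens (a a' : A) p : induced_act a (itens p a') = itens p (a' * a).
Proof. exact: (tlift_tens _ _ (induced_act_balanced a)). Qed.

Lemma induced_actDr : right_distributive induced_act +%R.
Proof. by move=> a x y; exact: (tliftD (induced_act_balanced a)). Qed.

Lemma induced_act0 a : induced_act a 0 = 0.
Proof. exact: (tlift0 (induced_act_balanced a)). Qed.

Lemma induced_actA (a b : A^c) x :
  induced_act a (induced_act b x) = induced_act (a * b) x.
Proof.
elim/induced_ind: x => [|x y hx hy|p c]; first by rewrite !induced_act0.
  by rewrite !induced_actDr hx hy.
by rewrite !induced_act_tens -mulrA.
Qed.

Lemma induced_act1 : left_id 1 induced_act.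
Proof.
elim/induced_ind=> [|x y hx hy|p c]; first by rewrite induced_act0.
  by rewrite induced_actDr hx hy.
by rewrite induced_act_tens mulr1.
Qed.

Lemma induced_actDl x : {morph induced_act^~ x : a b / a + b}.
Proof.
move=> a b; elim/induced_ind: x => [|x y hx hy|p c].
- by rewrite !induced_act0 addr0.
- by rewrite !induced_actDr hx hy addrACA.
by rewrite !induced_act_tens mulrDr itensDr.
Qed.

HB.instance Definition _ := GRing.Zmodule_isLmodule.Build A^c induced
  induced_actA induced_act1 induced_actDr induced_actDl.

Lemma itensZ (a a' : A) p : (a : A^c) *: itens p a' = itens p (a' * a).
Proof. exact: induced_act_tens. Qed.

(** The unit of the adjunction between extension and restriction of scalars. *)
Definition induced_unit (p : P) : restr inc induced := itens p 1.

Lemma induced_unit_linear : linear induced_unit.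
Proof.
move=> b p q; rewrite /induced_unit itensDl; congr (_ + _).
by rewrite restr_actE itensZ itens_mid mulr1 mul1r.
Qed.

HB.instance Definition _ := GRing.isLinear.Build B^c P (restr inc induced)
  _ induced_unit induced_unit_linear.

Section Lift.
Variables (M : lmodType A^c) (u : {linear P -> restr inc M}).

(** The adjunct of [u], sending p ⊗ a to u(p) a. *)
Definition ind_lift : induced -> M := tlift (fun p a => (a : A^c) *: (u p : M)).

Lemma ind_lift_balanced :
  @balanced B P A (fun p b => (b : B^c) *: p) (fun b a => inc b * a) _
    (fun p a => (a : A^c) *: (u p : M)).
Proof.
split=> [p q a|p a b|p b a].
- by rewrite [u _]raddfD [LHS]scalerDr.
- exact: (scalerDl (u p : M) (a : A^c) b).
- by rewrite [u _]linearZ /= restr_actE; apply: (scalerA (a : A^c) (inc b) (u p : M)).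
Qed.

Lemma ind_liftE p (a : A) : ind_lift (itens p a) = (a : A^c) *: (u p : M).
Proof. exact: (tlift_tens _ _ ind_lift_balanced). Qed.

Lemma ind_lift_linear : linear ind_lift.
Proof.
have lD := tliftD ind_lift_balanced; have l0 := tlift0 ind_lift_balanced.
rewrite -/ind_lift in lD l0.
move=> a x y; rewrite lD; congr (_ + _).
elim/induced_ind: x => [|x z hx hz|p b].
- by rewrite raddf0 l0 raddf0.
- by rewrite (scalerDr a) !lD hx hz (scalerDr a).
by rewrite itensZ !ind_liftE; apply/esym; apply: (scalerA a (b : A^c) (u p : M)).
Qed.

HB.instance Definition _ := GRing.isLinear.Build A^c induced M
  _ ind_lift ind_lift_linear.

End Lift.

End Induction.

(** * Induction along an extension with a homogeneous dual basis *)

Section DualBasis.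
Variables (k : fieldType) (A B : algType k).
Variables (gA : graded_algebra A) (gB : graded_algebra B).
Variable (inc : {rmorphism B -> A}).
Hypothesis inc_deg : forall n b, b \in in_deg gB n -> inc b \in in_deg gA n.
Variables (I : finType) (f : I -> {additive A -> B}) (r : I -> A).
Hypothesis fM : forall j b a, f j (inc b * a) = b * f j a.
Hypothesis f_deg : forall j n a, a \in in_deg gA n -> f j a \in in_deg gB n.
Hypothesis r_deg : forall j, r j \in in_deg gA 0.
Hypothesis dual : forall a, a = \sum_j inc (f j a) * r j.

Section Coordinates.
Variable P : lmodType B^c.
Local Notation T := (induced inc P).

(** The map id ⊗ [f j] from P ⊗_B A to P ⊗_B B, the latter being identified with P. *)
Definition icoord (j : I) : T -> P :=
  tlift (fun (p : P) (a : A) => (f j a : B^c) *: p).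

Lemma icoord_balanced j :
  @balanced B P A (fun p b => (b : B^c) *: p) (fun b a => inc b * a) _
    (fun (p : P) (a : A) => (f j a : B^c) *: p).
Proof.
split=> [p q a|p a b|p b a]; first exact: scalerDr.
  by rewrite raddfD; apply: (scalerDl p (f j a : B^c)).
by rewrite fM; apply: (scalerA (f j a : B^c) b p).
Qed.

Lemma icoord_tens j p a : icoord j (itens inc p a) = (f j a : B^c) *: p.
Proof. exact: (tlift_tens _ _ (icoord_balanced j)). Qed.

Lemma icoordD j : {morph icoord j : x y / x + y}.
Proof. exact: (tliftD (icoord_balanced j)). Qed.

Lemma icoord0 j : icoord j 0 = 0.
Proof. exact: (tlift0 (icoord_balanced j)). Qed.

Lemma icoord_sum j (J : Type) (s : seq J) F :
  icoord j (\sum_(i <- s) F i) = \sum_(i <- s) icoord j (F i).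
Proof. exact: (tlift_sum _ _ (icoord_balanced j)). Qed.

Lemma itens_sumr (J : Type) (s : seq J) (F : J -> A) (p : P) :
  itens inc p (\sum_(i <- s) F i) = \sum_(i <- s) itens inc p (F i).
Proof. exact: tens_sumr. Qed.

Lemma itens_suml (J : Type) (s : seq J) (F : J -> P) (a : A) :
  itens inc (\sum_(i <- s) F i) a = \sum_(i <- s) itens inc (F i) a.
Proof. exact: tens_suml. Qed.

Lemma itens0l (a : A) : itens inc (0 : P) a = 0.
Proof. exact: tens0l. Qed.

(** Expanding a in the dual basis gives p ⊗ a = sum p ⊗ f_j(a) r_j = sum p f_j(a) ⊗ r_j. Hence
    elements are determined by their coordinates. *)
Lemma icoordK (x : T) : x = \sum_j itens inc (icoord j x) (r j).
Proof.
elim/induced_ind: x => [|x y hx hy|p a].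
- by rewrite big1 // => j _; rewrite icoord0 itens0l.
- rewrite {1}hx {1}hy -big_split; apply: eq_bigr => j _ /=.
  by rewrite icoordD itensDl.
rewrite {1}[a]dual itens_sumr; apply: eq_bigr => j _.
by rewrite icoord_tens itens_mid.
Qed.

End Coordinates.

Section GradedInduction.
Variable P : graded_module gB.
Local Notation T := (induced inc P).

(* The r_j have degree 0, so the grading of P ⊗_B A is read off coordinates. *)
Definition induced_comp (i : int) (x : T) : T :=
  \sum_j itens inc (mcomp P i (icoord j x)) (r j).

Lemma f_r_deg0 i j : f i (r j) \in in_deg gB 0.
Proof. exact/f_deg/r_deg. Qed.

(** The coordinates of r_l are the [f j (r l)], which have degree 0, so their action commutes with
    the projections of P. *)
Lemma icoord_comp i j (x : T) : icoord j (induced_comp i x) = mcomp P i (icoord j x).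
Proof.
rewrite {2}[x]icoordK !icoord_sum raddf_sum; apply: eq_bigr => l _.
by rewrite !icoord_tens mcomp_act0 //; apply: f_r_deg0.
Qed.

Lemma icoord_inj (x y : T) : (forall j, icoord j x = icoord j y) -> x = y.
Proof. by move=> h; rewrite [x]icoordK [y]icoordK; apply: eq_bigr => j _; rewrite h. Qed.

Lemma induced_comp_additive i : zmod_morphism (induced_comp i).
Proof.
have icoordB j (x y : T) : icoord j (x - y) = icoord j x - icoord j y.
  by apply/eqP; rewrite eq_sym subr_eq -icoordD subrK.
by move=> x y; apply: icoord_inj => j; rewrite icoordB !icoord_comp icoordB raddfB.
Qed.

HB.instance Definition _ i := GRing.isZmodMorphism.Build T T
  (induced_comp i) (induced_comp_additive i).

Lemma induced_decomp : is_decomposition induced_comp.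
Proof.
have [orth dec] := mcomp_decomp P.
split=> [i j x|x].
  apply: icoord_inj => l; rewrite !icoord_comp orth.
  by case: eqP => _; rewrite ?icoord_comp ?icoord0.
(* One list of degrees has to serve all the finitely many coordinates at once. *)
have [s us hs] := decomp_family (mcomp_decomp P) (fun j => icoord j x).
exists s => //; apply: icoord_inj => j; rewrite icoord_sum hs.
by apply: eq_bigr => i _; rewrite icoord_comp.
Qed.

Lemma induced_homogP i (x : T) :
  reflect (forall j, icoord j x \in in_mdeg P i) (x \in homog induced_comp i).
Proof.
apply: (iffP eqP) => [<- j|h]; first by rewrite icoord_comp mcomp_homog.
by apply: icoord_inj => j; rewrite icoord_comp; apply/eqP/h.
Qed.

Lemma itens_homog i n p a :
  p \in in_mdeg P i -> a \in in_deg gA n ->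
  itens inc p a \in homog induced_comp (i + n%:Z).
Proof.
move=> hp ha; apply/induced_homogP => j; rewrite icoord_tens.
exact: (@mcomp_act _ _ _ P _ _ _ _ hp (f_deg j ha)).
Qed.

Lemma induced_comp_act (i : int) (n : nat) (x : T) (a : A) :
  x \in homog induced_comp i -> a \in in_deg gA n ->
  (a : A^c) *: x \in homog induced_comp (i + n%:Z).
Proof.
move=> /induced_homogP hx ha; rewrite [x]icoordK (scaler_sumr (a : A^c)).
apply/eqP; rewrite raddf_sum; apply: eq_bigr => j _; apply/eqP.
rewrite itensZ; apply: itens_homog (hx j) _; exact: acomp_mul (r_deg j) ha.
Qed.

Definition induced_module : graded_module gA :=
  @GradedModule _ _ gA T induced_comp induced_decomp induced_comp_act.

Lemma ind_lift_homog (M : graded_module gA) (u : {linear P -> restr inc M}) :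
  graded_hom (M := P) (N := restr_module inc_deg M) u ->
  graded_hom (M := induced_module) (N := M) (ind_lift u).
Proof.
move=> hu i x /induced_homogP hx; rewrite [x]icoordK raddf_sum.
apply: in_mdeg_sum => j _; rewrite /= ind_liftE.
by apply: act0_homog (r_deg j); apply: (hu i _ (hx j)).
Qed.

Lemma induced_unit_homog :
  graded_hom (M := P) (N := restr_module inc_deg induced_module)
    (induced_unit inc (P := P)).
Proof.
move=> i p hp; have := itens_homog hp (acomp_one gA); by rewrite addr0.
Qed.

(** Restriction preserves surjections, so its left adjoint preserves projectives: the B-linear map
    adjoint to [h] is lifted through [g], and the lift is extended A-linearly. *)
Lemma induced_projective : graded_projective P -> graded_projective induced_module.
Proof.
move=> projP M N g h hg gs hh.
have gl : linear (g : restr inc M -> restr inc N).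
  by move=> b x y; rewrite [LHS]raddfD /= restr_actE [g _]linearZ.
pose g' : {linear restr inc M -> restr inc N} :=
  HB.pack (g : restr inc M -> restr inc N)
   (GRing.isLinear.Build B^c (restr inc M) (restr inc N) _ _ gl).
have hl : linear (fun p => h (induced_unit inc p) : restr inc N).
  move=> b x y; rewrite [induced_unit _ _]linearP [LHS]raddfD /= restr_actE.
  by congr (_ + _); rewrite [LHS]linearZ.
pose h' : {linear P -> restr inc N} :=
  HB.pack (fun p => h (induced_unit inc p) : restr inc N)
   (GRing.isLinear.Build B^c P (restr inc N) _ _ hl).
have [||u hu uP] := projP (restr_module inc_deg M) (restr_module inc_deg N) g' h' _ gs.
- exact: hg.
- by move=> i p hp; apply/hh/induced_unit_homog.
exists (ind_lift u); first exact: ind_lift_homog.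
move=> x; elim/induced_ind: x => [|x y hx hy|p a].
- by rewrite !raddf0.
- by rewrite !raddfD /= hx hy.
(* By A-linearity it suffices to compare the two maps on the elements p ⊗ 1. *)
have -> : itens inc p a = (a : A^c) *: itens inc p 1 by rewrite itensZ mul1r.
rewrite !linearZ /=; congr (_ *: _).
by rewrite ind_liftE scale1r; apply: uP.
Qed.

(** If p = sum q b with each q of degree [d], then p ⊗ a = sum (q ⊗ 1) (b a), and each q ⊗ 1 again
    has degree [d]. *)
Lemma induced_generated d :
  generated_in_degree P d -> generated_in_degree induced_module d.
Proof.
move=> genP x.
have gen p a : exists2 s : seq (induced_module * A),
    all (fun p => p.1 \in in_mdeg induced_module d) s
    & itens inc p a = \sum_(p <- s) (p.2 : A^c) *: p.1.
  have [s /allP hs ->] := genP p.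
  exists [seq (itens inc q.1 1 : induced_module, inc q.2 * a) | q <- s].
    by apply/allP=> _ /mapP[q /hs qd ->]; apply: induced_unit_homog.
  rewrite itens_suml big_map; apply: eq_bigr => q _ /=.
  by rewrite itens_mid itensZ mul1r.
elim/induced_ind: x => [|x y [s hs ->] [t ht ->]|p a]; last exact: gen.
  by exists [::] => //; rewrite big_nil.
by exists (s ++ t); rewrite ?all_cat ?hs ?ht // big_cat.
Qed.

End GradedInduction.

Local Notation ind P := (induced_module P).

Lemma f_comp j n a : f j (gA n a) = gB n (f j a).
Proof.
have [_ dec] := acomp_decomp gA; have [s _ ->] := dec a.
rewrite !raddf_sum; apply: eq_bigr => i _ /=.
have hi := acomp_homog gA i a; have hfi := f_deg j hi.
have [->|ni] := eqVneq n i; first by rewrite (homogP _ _ _ hi) (homogP _ _ _ hfi).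
by rewrite (acomp_other hi ni) (acomp_other hfi ni) raddf0.
Qed.

Section Map.
Variables (P Q : lmodType B^c) (u : {linear P -> Q}).

Definition unit_comp (p : P) : restr inc (induced inc Q) := induced_unit inc (u p).

Lemma unit_comp_linear : linear unit_comp.
Proof. by move=> b x y; rewrite /unit_comp !linearP. Qed.

HB.instance Definition _ := GRing.isLinear.Build B^c P (restr inc (induced inc Q))
  _ unit_comp unit_comp_linear.

Definition ind_map : {linear induced inc P -> induced inc Q} := ind_lift unit_comp.

Lemma ind_map_tens p a : ind_map (itens inc p a) = itens inc (u p) a.
Proof. by rewrite /ind_map /= ind_liftE [LHS]itensZ mul1r. Qed.

(** Coordinates are natural in the module because [u] commutes with the action of [f j a]; kernels
    and images of [ind_map u] can thus be studied coordinatewise. *)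
Lemma icoord_map j x : icoord j (ind_map x) = u (icoord j x).
Proof.
elim/induced_ind: x => [|x y hx hy|p a].
- by rewrite raddf0 !icoord0 raddf0.
- by rewrite raddfD !icoordD hx hy raddfD.
by rewrite ind_map_tens !icoord_tens linearZ.
Qed.

End Map.

Lemma ind_map_homog (P Q : graded_module gB) (u : {linear P -> Q}) :
  graded_hom u -> graded_hom (M := ind P) (N := ind Q) (ind_map u).
Proof.
move=> hu i x /induced_homogP hx; apply/induced_homogP => j.
by rewrite icoord_map; apply/hu/hx.
Qed.

(** This is flatness of A over B in coordinates: those of an element killed by [ind_map v] are
    killed by [v], hence lie in the image of [u], and their preimages are reassembled along the
    r_j. *)
Lemma ind_map_exact (P Q S : lmodType B^c)
    (u : {linear P -> Q}) (v : {linear Q -> S}) :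
  (forall x, v x = 0 <-> exists y, u y = x) ->
  forall x, ind_map v x = 0 <-> exists y, ind_map u y = x.
Proof.
move=> ex x; split=> [vx0|[y <-]].
  have /fin_all_exists[y hy] j : exists y, u y = icoord j x.
    by apply/ex; rewrite -icoord_map vx0 icoord0.
  exists (\sum_j itens inc (y j) (r j)).
  rewrite raddf_sum [RHS]icoordK; apply: eq_bigr => j _.
  by rewrite [LHS]ind_map_tens hy.
rewrite [LHS]icoordK big1 // => j _.
by rewrite !icoord_map (_ : v _ = 0) ?itens0l //; apply/ex; exists (icoord j y).
Qed.

(** * Augmentation of the induced resolution *)

Section Augmentation.
Variables (P : lmodType B^c) (e : {linear P -> trivial_module gB}).

Lemma aug_subproof (x : trivial_module gB) :
  inc (val (x : subalgebra (deg0 gB))) \in deg0 gA.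
Proof. exact: inc_deg (valP (x : subalgebra (deg0 gB))). Qed.

Definition aug_unit (p : P) : restr inc (trivial_module gA) :=
  Subalgebra (aug_subproof (e p)).

Lemma aug_unit_linear : linear aug_unit.
Proof.
move=> b x y; apply: val_inj; rewrite /aug_unit /= linearP /=.
rewrite rmorphD rmorphM; congr (_ * _ + _).
(* What remains is that [inc] commutes with the projections onto degree 0. *)
have [_ dec] := acomp_decomp gB; have [s _ ->] := dec b.
rewrite !raddf_sum; apply: eq_bigr => i _ /=.
have hi := acomp_homog gB i b; have hii := inc_deg hi.
have [<-|ni] := eqVneq 0%N i; first
  by rewrite (homogP _ _ _ (acomp_homog gB 0 b))
       (homogP _ _ _ (inc_deg (acomp_homog gB 0 b))).
by rewrite (acomp_other hi ni) (acomp_other hii ni) raddf0.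
Qed.

HB.instance Definition _ := GRing.isLinear.Build B^c P (restr inc (trivial_module gA))
  _ aug_unit aug_unit_linear.

(** The map [e] ⊗ id, followed by b ⊗ a |-> b a_0 from B_0 ⊗_B A to A_0, where a_0 is the
    degree-zero component of a. *)
Definition aug : {linear induced inc P -> trivial_module gA} := ind_lift aug_unit.

Lemma aug_tens p a :
  aug (itens inc p a) = (a : A^c) *: (aug_unit p : trivial_module gA).
Proof. exact: ind_liftE. Qed.

(** Since [f j] is left B-linear and preserves degrees, both sides send p ⊗ a to e(p) f_j(a)_0. The
    kernel of [aug] is read off from that of [e] in this way. *)
Lemma icoord_aug j x :
  val (e (icoord j x) : subalgebra (deg0 gB))
  = f j (val (aug x : subalgebra (deg0 gA))).
Proof.
elim/induced_ind: x => [|x y hx hy|p a].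
- by rewrite icoord0 !raddf0.
- by rewrite icoordD !raddfD /= hx hy.
by rewrite icoord_tens aug_tens linearZ /= fM f_comp.
Qed.

End Augmentation.

Lemma trivial_koszul N :
  N_koszul_module N (trivial_module gB) -> N_koszul_module N (trivial_module gA).
Proof.
move=> [P [d [e [proj [dh eh] es [ex0 ex] gen]]]].
exists (fun n => ind (P n)), (fun n => ind_map (d n)), (aug e); split.
- by move=> n; apply: induced_projective.
- split=> [n|]; first exact: ind_map_homog.
  apply: (ind_lift_homog ) => i p hp.
  have /eqP := eh i p hp; rewrite inE /= /restr_comp /= => he.
  apply/eqP; apply: val_inj; move/(congr1 val): he; rewrite /= /trivial_comp.
  by case: eqP => //= _ <-; rewrite raddf0.
- move=> y.
  (* The element y of A_0 is the sum of the f_j(y) r_j with f_j(y) in B_0; lifting each f_j(y)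
     through [e] gives a preimage. *)
  have fy j : f j (val (y : subalgebra (deg0 gA))) \in deg0 gB.
    exact: f_deg (valP (y : subalgebra (deg0 gA))).
  have /fin_all_exists[x hx] j : exists x, e x = Subalgebra (fy j) by apply: es.
  exists (\sum_j itens inc (x j) (r j)); rewrite raddf_sum; apply: val_inj.
  rewrite raddf_sum /= [RHS]dual; apply: eq_bigr => j _.
  by rewrite [aug _ _]aug_tens /= hx /= (homogP _ _ _ (r_deg j)).
- split=> [x|n]; last exact: ind_map_exact.
  split=> [ex0x|[y <-]].
    have /fin_all_exists[y hy] j : exists y, d 0%N y = icoord j x.
      by apply/ex0; apply: val_inj; rewrite [LHS]icoord_aug ex0x raddf0.
    exists (\sum_j itens inc (y j) (r j)).
    rewrite raddf_sum [RHS]icoordK; apply: eq_bigr => j _.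
    by rewrite [LHS]ind_map_tens hy.
  (* By the dual basis, an element of A_0 vanishes once all its images under the [f j] do. *)
  apply: val_inj; rewrite [LHS]dual big1 // => j _.
  rewrite -icoord_aug icoord_map (_ : e _ = 0) ?rmorph0 ?mul0r //.
  by apply/ex0; exists (icoord j y).
- by move=> n n0; apply/induced_generated/gen.
Qed.

End DualBasis.

(** * Semisimplicity of separable extensions *)

Section SemisimpleExtension.
Variables (R S : nzRingType) (i : {rmorphism R -> S}).

Definition rsubmod (U : {pred S}) : Prop :=
  0 \in U /\ forall c u v, u \in U -> v \in U -> u * i c + v \in U.

Lemma rsubmodD U u v : rsubmod U -> u \in U -> v \in U -> u + v \in U.
Proof. by move=> [_ h] hu hv; rewrite -[u]mulr1 -(rmorph1 i) h. Qed.

Lemma rsubmodM U u c : rsubmod U -> u \in U -> u * i c \in U.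
Proof. by move=> [h0 h] hu; rewrite -[_ * _]addr0 h. Qed.

Lemma rsubmodN U u : rsubmod U -> u \in U -> - u \in U.
Proof. by move=> hU hu; rewrite -mulrN1 -(rmorph1 i) -rmorphN rsubmodM. Qed.

Lemma rsubmodB U u v : rsubmod U -> u \in U -> v \in U -> u - v \in U.
Proof. by move=> hU hu hv; apply: rsubmodD => //; apply: rsubmodN. Qed.

(** Semisimplicity of R supplies complements of right ideals of R only, so a complement of [U] is
    built by adding one generator at a time. *)
Lemma rsubmod_complement (U : {pred S}) (gens : seq S) :
  semisimple_ring R -> rsubmod U ->
  exists W : {pred S}, [/\ rsubmod W,
    forall w, w \in W -> w \in U -> w = 0
  & forall x, x \in gens -> forall c, exists2 u, u \in U & x * i c - u \in W].
Proof.
move=> ssR hU; elim: gens => [|x gens [W [hW WU gW]]].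
  exists ([pred w : S | w == 0] : {pred S}); split=> // [|w /eqP //].
  by split=> [|c u v /eqP -> /eqP ->]; rewrite inE ?mul0r ?addr0.
(* The elements c of R with x c in U + W form a right ideal J; a complement L
   of J in R gives the complement W + x L of U in the span of one more element. *)
pose J : {pred (R^c)^o} := [pred c | `[< exists2 u, u \in U & x * i c - u \in W >]].
have [|L [[L0 hL] cover LJ]] := ssR J.
  split=> [|c a b /asboolP[u hu hw] /asboolP[v hv hw']]; apply/asboolP.
    by exists 0; rewrite ?rmorph0 ?mulr0 ?subr0; [case: hU|case: hW].
  exists (u * i c + v); first by case: hU => _; apply.
  have -> : x * i (c *: a + b) - (u * i c + v) = (x * i a - u) * i c + (x * i b - v).
    have -> : i (c *: a + b) = i a * i c + i b by rewrite rmorphD -rmorphM.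
    by rewrite mulrDr mulrBl mulrA opprD addrACA.
  by case: hW => _; apply.
pose W' : {pred S} := [pred y : S | `[< exists2 c, c \in L & y - x * i c \in W >]].
have WW' w : w \in W -> w \in W'.
  by move=> hw; apply/asboolP; exists 0; rewrite ?rmorph0 ?mulr0 ?subr0.
exists W'; split.
- split=> [|c u v /asboolP[a ha hu] /asboolP[b hb hv]].
    by apply: WW'; case: hW.
  apply/asboolP; exists ((c : R^c) *: (a : (R^c)^o) + b); first exact: hL.
  have -> : i ((c : R^c) *: (a : (R^c)^o) + b) = i a * i c + i b.
    by rewrite rmorphD -rmorphM.
  have -> : u * i c + v - x * (i a * i c + i b) = (u - x * i a) * i c + (v - x * i b).
    by rewrite mulrDr mulrBl mulrA opprD addrACA.
  by case: hW => _; apply.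
- move=> w /asboolP[c cL hw] wU.
  (* As w lies in U and w - x c in W, the element x c is in U + W; so c belongs to both J and L and
     is zero. *)
  have cJ : c \in J.
    apply/asboolP; exists w => //.
    by rewrite -opprB rsubmodN.
  have c0 := LJ c cJ cL; rewrite c0 rmorph0 mulr0 subr0 in hw.
  exact: WU.
move=> y; rewrite inE => /predU1P[-> c|yg c].
  (* With c = a + b, a in J and b in L, one has x c - u = (x a - u) + x b, whose first term is in
     W. *)
  have [a [b [/asboolP[u hu ha] hb ->]]] := cover c.
  exists u => //; apply/asboolP; exists b => //.
  by rewrite rmorphD mulrDr addrAC addrK.
by have [u hu hw] := gW y yg c; exists u => //; apply: WW'.
Qed.

(** Maschke's argument with a separability element: [xs] represents an element of S ⊗_R S that
    commutes with S and has product 1. Averaging an R-linear projection [pi] onto a right ideal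
    yields the S-linear map m |-> sum pi(m x) y, still the identity on the ideal. *)
Lemma semisimple_extension (I : finType) (g : I -> S) (xs : seq (S * S)) :
  (forall s, exists c : I -> R, s = \sum_j g j * i (c j)) ->
  \sum_(p <- xs) p.1 * p.2 = 1 ->
  (forall (f : S -> S -> S),
     balanced (fun s c => s * i c) (fun c s => i c * s) f ->
     forall a, \sum_(p <- xs) f (a * p.1) p.2 = \sum_(p <- xs) f p.1 (p.2 * a)) ->
  semisimple_ring R -> semisimple_ring S.
Proof.
move=> gen xs1 xsC ssR V [V0 VA]; pose U : {pred S} := V.
have hUS (u s v : S) : u \in U -> v \in U -> u * s + v \in U by exact: (VA s u v).
have hU : rsubmod U by split=> // c u v; apply: hUS.
have [W [hW WU gW]] := rsubmod_complement [seq g j | j <- enum I] ssR hU.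
have cover (s : S) : exists u : S, u \in U /\ s - u \in W.
  have [c ->] := gen s.
  elim/big_ind: _ => [|x y [u [hu hx]] [v [hv hy]]|j _].
  - by exists 0; rewrite subr0; split=> //; case: hW.
  - by exists (u + v); rewrite opprD addrACA; split; apply: rsubmodD.
  have [|u hu hw] := gW (g j) _ (c j); last by exists u.
  by apply: map_f; rewrite mem_enum.
(* The component in U is chosen for each s, but it is unique because U and W meet in 0; this makes
   [pi] R-linear. *)
have [pi /all_and2[piU piW]] := choice cover.
have pi_uniq s u : u \in U -> s - u \in W -> pi s = u.
  move=> uU uW; apply/eqP; rewrite -subr_eq0; apply/eqP/WU; last exact: rsubmodB.
  have -> : pi s - u = (s - u) - (s - pi s) by rewrite opprB [RHS]addrC addrA subrK.
  exact: rsubmodB.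
have piD s t : pi (s + t) = pi s + pi t.
  by apply: pi_uniq; rewrite ?opprD 1?addrACA rsubmodD.
have piM s c : pi (s * i c) = pi s * i c.
  by apply: pi_uniq; rewrite -?mulrBl rsubmodM.
have pi_id u : u \in U -> pi u = u.
  by move=> hu; apply: pi_uniq; rewrite ?subrr //; case: hW.
pose f m s t : S := pi (m * s) * t.
pose avg m : S := \sum_(p <- xs) f m p.1 p.2.
have bf m : balanced (fun s c => s * i c) (fun c s => i c * s) (f m).
  split=> [s s' t|s t t'|s c t]; rewrite /f ?mulrDr ?piD ?mulrDl //.
  by rewrite [m * (s * _)]mulrA piM mulrA.
(* Centrality of [xs] moves a from inside [pi] to the right of the second factor. *)
have avgM m a : avg (m * a) = avg m * a.
  rewrite /avg (eq_bigr (fun p => f m (a * p.1) p.2)); last first.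
    by move=> p _; rewrite /f mulrA.
  rewrite (xsC _ (bf m)) mulr_suml; apply: eq_bigr => p _.
  by rewrite /f mulrA.
have avgD m n : avg (m + n) = avg m + avg n.
  by rewrite -big_split; apply: eq_bigr => p _; rewrite /f mulrDl piD mulrDl.
have avgU m : avg m \in U.
  rewrite /avg; elim/big_ind: _ => // [u v|p _]; first exact: rsubmodD.
  by rewrite -[f _ _ _]addr0 hUS.
have avg_id u : u \in U -> avg u = u.
  move=> hu; rewrite -[RHS]mulr1 -xs1 mulr_sumr; apply: eq_bigr => p _.
  rewrite /f pi_id ?mulrA //.
  by rewrite -[_ * _]addr0 hUS.
have avg0 : avg 0 = 0 by apply: avg_id.
(* The complement is the kernel of the idempotent [avg]. *)
exists ([pred m : S | avg m == 0] : {pred S}); split.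
- split=> [|a u v]; rewrite !inE ?avg0 // => /eqP hu /eqP hv.
  by rewrite avgD (avgM u a) hu hv mul0r addr0.
- move=> m; exists (avg m), (m - avg m); split;
    [exact: avgU| |by rewrite addrC subrK].
  rewrite inE -[X in X == _](addrK (avg (avg m))) -avgD subrK.
  by rewrite [avg (avg m)]avg_id ?subrr.
by move=> m hm; rewrite inE avg_id // => /eqP.
Qed.

End SemisimpleExtension.

(** * Integrals *)

Section TensorCalculus.
Variables (R : Type) (M N : zmodType).
Variables (ract : M -> R -> M) (lact : R -> N -> N).
Local Notation T := (tensor ract lact).

Lemma raddf_tlift (G G' : zmodType) (g : {additive G -> G'}) (f : M -> N -> G) (t : T) :
  g (tlift f t) = tlift (fun m n => g (f m n)) t.
Proof. exact: raddf_sum. Qed.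

Lemma eq_tlift (G : zmodType) (f g : M -> N -> G) (t : T) :
  (forall m n, f m n = g m n) -> tlift f t = tlift g t.
Proof. by move=> fg; apply: eq_bigr => p _. Qed.

Lemma tlift_tlift (R' : Type) (M' N' : zmodType) (ract' : M' -> R' -> M')
    (lact' : R' -> N' -> N') (G : zmodType) (F : M' -> N' -> G)
    (f : M -> N -> tensor ract' lact') (t : T) :
  balanced ract' lact' F -> tlift F (tlift f t) = tlift (fun m n => tlift F (f m n)) t.
Proof. exact: tlift_sum. Qed.

End TensorCalculus.

Section KTensor.
Variables (k : fieldType) (A H : algType k).
Implicit Types (x y z : (A ⊗ H)%type) (theta : {linear H -> k^o}).

Lemma ktensDl (a a' : A) (h : H) : (a + a') ⊗ h = a ⊗ h + a' ⊗ h.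
Proof. by case: (ktens_balanced A H) => -> _ _. Qed.

Lemma ktensDr (a : A) (h h' : H) : a ⊗ (h + h') = a ⊗ h + a ⊗ h'.
Proof. by case: (ktens_balanced A H) => _ -> _. Qed.

Lemma ktens0l (h : H) : (0 : A) ⊗ h = 0.
Proof. exact: balanced0l (ktens_balanced A H) h. Qed.

Lemma tmulDl x y z : tmul (x + y) z = tmul x z + tmul y z.
Proof. exact: (tliftD (tmul_outer_balanced z)). Qed.

Lemma tmul0l z : tmul 0 z = 0 :> (A ⊗ H)%type.
Proof. exact: (tlift0 (tmul_outer_balanced z)). Qed.

Lemma tmulDr x y z : tmul x (y + z) = tmul x y + tmul x z.
Proof.
elim/ktensor_ind: x => [|x x' hx hx'|a h]; rewrite ?tmul0l ?addr0 //.
  by rewrite !tmulDl hx hx' addrACA.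
rewrite /tmul !(tlift_tens _ _ (tmul_outer_balanced _)).
exact: (tliftD (tmul_inner_balanced a h)).
Qed.

Lemma tmul0r x : tmul x 0 = 0.
Proof. by apply: (addrI (tmul x 0)); rewrite -tmulDr !addr0. Qed.

Lemma tmul_sumr (I : Type) (s : seq I) (F : I -> (A ⊗ H)%type) x :
  tmul x (\sum_(i <- s) F i) = \sum_(i <- s) tmul x (F i).
Proof. by apply: (big_morph (tmul x)) => [y z|]; [exact: tmulDr|exact: tmul0r]. Qed.

Lemma tmul_suml (I : Type) (s : seq I) (F : I -> (A ⊗ H)%type) x :
  tmul (\sum_(i <- s) F i) x = \sum_(i <- s) tmul (F i) x.
Proof. exact: (big_morph (fun y => tmul y x) (fun y z => tmulDl y z x) (tmul0l x)). Qed.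

Lemma tmulA x y z : tmul x (tmul y z) = tmul (tmul x y) z.
Proof.
elim/ktensor_ind: x => [|x x' hx hx'|a h]; rewrite ?tmul0l //.
  by rewrite !tmulDl hx hx'.
elim/ktensor_ind: y => [|y y' hy hy'|b g]; rewrite ?(tmul0l, tmul0r) ?tmul0l //.
  by rewrite tmulDl !tmulDr hy hy' tmulDl.
elim/ktensor_ind: z => [|z z' hz hz'|c l]; rewrite ?tmul0r //.
  by rewrite !tmulDr hz hz'.
by rewrite !tmul_tens !mulrA.
Qed.

(** The slice map id ⊗ [theta]. *)
Definition tens_eval theta : (A ⊗ H)%type -> A :=
  tlift (fun a h => (theta h : k) *: a).

Lemma tens_eval_balanced theta :
  kbalanced (fun (a : A) (h : H) => (theta h : k) *: a).
Proof.
apply: klift_balanced => [h c a b|a c h g].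
  by rewrite scalerDr !scalerA mulrC.
by rewrite linearP scalerDl -scalerA.
Qed.

Lemma tens_eval_linear theta : linear (tens_eval theta).
Proof.
apply: klift_linear => [h c a b|a c h g].
  by rewrite scalerDr !scalerA mulrC.
by rewrite linearP scalerDl -scalerA.
Qed.

HB.instance Definition _ theta := GRing.isLinear.Build k (A ⊗ H)%type A _
  (tens_eval theta) (tens_eval_linear theta).

Lemma tens_eval_tens theta a h : tens_eval theta (a ⊗ h) = (theta h : k) *: a.
Proof. exact: (tlift_tens _ _ (tens_eval_balanced theta)). Qed.

Lemma tens_eval_mull theta b x :
  tens_eval theta (tmul (b ⊗ 1) x) = b * tens_eval theta x.
Proof.
elim/ktensor_ind: x => [|x y hx hy|a h].
- by rewrite tmul0r !raddf0 mulr0.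
- by rewrite tmulDr !raddfD /= hx hy mulrDr.
by rewrite tmul_tens !tens_eval_tens mul1r -scalerAr.
Qed.

Lemma tens_eval_mulr theta b x :
  tens_eval theta (tmul x (b ⊗ 1)) = tens_eval theta x * b.
Proof.
elim/ktensor_ind: x => [|x y hx hy|a h].
- by rewrite tmul0l !raddf0 mul0r.
- by rewrite tmulDl !raddfD /= hx hy mulrDl.
by rewrite tmul_tens !tens_eval_tens mulr1 -scalerAl.
Qed.

End KTensor.

Section Integrals.
Variables (k : fieldType) (H : falgType k) (HH : hopf_algebra H).

(** The kernel of the counit is a right ideal; [t] is the component of 1 in a complement W. Then t h
    - eps(h) t = t (h - eps(h)) lies in W and in the kernel, hence vanishes. *)
Lemma semisimple_integral :
  semisimple_ring H ->
  exists2 t : H, counit HH t = 1 & forall h, t * h = (counit HH h : k) *: t.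
Proof.
move=> ssH; pose U : {pred (H^c)^o} := [pred h : H | counit HH h == 0].
have [|W [[W0 WA] cover WU]] := ssH U.
  split=> [|c u v]; rewrite !inE ?raddf0 // => /eqP hu /eqP hv.
  rewrite raddfD /= hv addr0.
  by rewrite (rmorphM (counit HH) (u : H) (c : H)) /= hu mul0r.
have [u [t [uU tW one]]] := cover (1 : H).
have t1 : counit HH t = 1.
  have := congr1 (counit HH) one; rewrite raddfD rmorph1 /=.
  by move: uU; rewrite inE => /eqP ->; rewrite add0r.
exists (t : H) => // h; apply/eqP; rewrite -subr_eq0; apply/eqP; apply: WU.
  rewrite inE raddfB /= linearZ /= (rmorphM (counit HH) (t : H) (h : H)) /= t1.
  by rewrite mul1r [_ *: _]mulr1 subrr.
have -> : (t : H) * h - (counit HH h : k) *: (t : H)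
        = (t : H) * (h - (counit HH h : k)%:A).
  by rewrite mulrBr -scalerAr mulr1.
by have := WA (h - (counit HH h : k)%:A) t 0 tW W0; rewrite addr0.
Qed.

Lemma dual_vector (v : H) : v != 0 -> exists theta : {linear H -> k^o}, theta v = 1.
Proof.
move=> v0; have [j cj] : exists j, coord (vbasis fullv) j v != 0.
  apply/existsP; apply: contraNT v0; rewrite negb_exists => /forallP h.
  rewrite (coord_vbasis (memvf v)) big1 // => j _.
  by have := h j; rewrite negbK => /eqP ->; rewrite scale0r.
pose g h : k^o := (coord (vbasis fullv) j v)^-1 * coord (vbasis fullv) j h.
have gl : linear g by move=> c x y; rewrite /g linearP mulrDr [in RHS]/( _ *: _) /= mulrCA.
pose theta : {linear H -> k^o} := HB.pack g (GRing.isLinear.Build k H k^o _ g gl).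
exists theta.
by rewrite /= /g mulVf.
Qed.

Section SimpleDecomposition.
Variables (n : nat) (D : 'I_n -> {vspace H}).
Hypothesis simpD : forall i, simple_subcoalgebra HH (D i).
Hypothesis dirD : directv (\sum_i D i).
Hypothesis fullD : (\sum_i D i)%VS = fullv.

Definition block_proj i : 'End(H) := sumv_pi_for (esym fullD) i.
Local Notation pr := block_proj.

Lemma block_proj_mem i h : pr i h \in D i.
Proof. exact: memv_sum_pi. Qed.

Lemma block_proj_sum h : \sum_i pr i h = h.
Proof. exact: sumv_pi_sum (memvf h). Qed.

Lemma block_proj_in i j h : h \in D j -> pr i h = if i == j then h else 0.
Proof.
move=> hj; pose us l := if l == j then h else 0.
have /directv_sum_unique := dirD.
move/(_ (fun l => pr l h) us); rewrite block_proj_sum.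
have -> : \sum_l us l = h.
  by rewrite (bigD1 j) //= /us eqxx big1 ?addr0 // => l /negPf ->.
rewrite eqxx => uniq.
suff /forallP/(_ i)/eqP : [forall l, pr l h == us l] by [].
rewrite -uniq // => l _; first exact: memv_sum_pi.
by rewrite /us; case: eqP => [->|_]; rewrite ?mem0v.
Qed.

(** Only one block component of 1 is nonzero, so 1 lies in some [D i]. The line through 1 is a
    nonzero subcoalgebra of it, hence all of it by simplicity. *)
Lemma one_in_simple : exists i, D i = <[1]>%VS.
Proof.
have [i hi] : exists i, pr i 1 != 0.
  apply/existsP; apply: contraT; rewrite negb_exists => /forallP h.
  have /eqP := oner_neq0 H; case; rewrite -(block_proj_sum 1) big1 // => j _.
  by apply/eqP; rewrite -[_ == _]negbK.
(* Since 1 ⊗ 1 = comul 1 lies in the sum of the D_l ⊗ D_l, its component in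
   D_i ⊗ D_j vanishes. *)
have other j : j != i -> pr j 1 = 0.
  move=> ji; apply/eqP; apply: contraT => hj.
  have [[th thi] [ps psj]] := (dual_vector hi, dual_vector hj).
  pose F (x y : H) : k^o := th (pr i x) * ps (pr j y).
  have bF : kbalanced F.
    apply: klift_balanced => [y c u v|y c u v]; rewrite /F !linearP /=.
      by rewrite mulrDl scalerAl.
    by rewrite mulrDr scalerAr.
  have lF : linear (tlift F : (H ⊗ H)%type -> k^o).
    apply: klift_linear => [y c u v|y c u v]; rewrite /F !linearP /=.
      by rewrite mulrDl scalerAl.
    by rewrite mulrDr scalerAr.
  have : tlift F (comul HH 1) = 1.
    by rewrite comul1 (tlift_tens _ _ bF) /F thi psj mulr1.
  rewrite -[X in comul HH X]block_proj_sum raddf_sum (tlift_sum _ _ bF) big1.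
    by move/eqP; rewrite eq_sym oner_eq0.
  move=> l _; have [coD _ _] := simpD l.
  rewrite /=; have [s /allP hs ->] := coD _ (block_proj_mem l 1).
  rewrite (tlift_sum _ _ bF) big_seq big1 // => p /hs /andP[p1 p2].
  rewrite (tlift_tens _ _ bF) /F (block_proj_in i p1) (block_proj_in j p2).
  have [il|il] := eqVneq i l; last by rewrite raddf0 mul0r.
  by rewrite -il (negPf ji) raddf0 mulr0.
have one_i : 1 \in D i.
  suff -> : 1 = pr i 1 by apply: block_proj_mem.
  rewrite -[LHS]block_proj_sum [LHS](bigD1 i) //= big1 ?addr0 //.
exists i; have [_ _ simp] := simpD i; case: (simp <[1]>%VS) => //.
- move=> _ /vlineP[c ->]; exists [:: (c *: 1, 1)] => /=.
    by rewrite memvZ ?memv_line.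
  by rewrite big_seq1 linearZ /= comul1 [LHS]ktensZl.
- by move=> h; have := memv_line (1 : H); rewrite h memv0 oner_eq0.
Qed.

End SimpleDecomposition.

(** Take for [la] a functional with value 1 at 1, composed with the projection onto the block k1. On
    k1 the identity is direct; any other block is a subcoalgebra on which [la] vanishes, so both
    sides are 0 there. *)
Lemma cosemisimple_integral :
  cosemisimple HH ->
  exists2 la : {linear H -> k^o}, la 1 = 1
    & forall h, tens_eval la (comul HH h) = (la h : k)%:A.
Proof.
move=> [n [D [simpD dirD fullD]]].
have [i Di] := one_in_simple simpD dirD fullD.
have [ps ps1] := dual_vector (oner_neq0 H).
have [la la1 la0] : exists2 la : {linear H -> k^o}, la 1 = 1
    & forall j x, j != i -> x \in D j -> la x = 0.
  pose g h : k^o := ps (block_proj fullD i h).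
  have gl : linear g by move=> c x y; rewrite /g !linearP.
  exists (HB.pack_for {linear H -> k^o} g (GRing.isLinear.Build k H k^o _ g gl)).
    have i1 : 1 \in D i by rewrite Di memv_line.
    by rewrite /= /g (block_proj_in dirD _ _ i1) eqxx.
  move=> j x ji hx.
  by rewrite /= /g (block_proj_in dirD _ _ hx) eq_sym (negPf ji) raddf0.
exists la => // h.
rewrite -[h](block_proj_sum fullD) !raddf_sum scaler_suml; apply: eq_bigr => j _ /=.
have hj := block_proj_mem fullD j h; move: (block_proj fullD j h) hj => {}h hj.
have [ji|ji] := eqVneq j i.
  move: hj; rewrite ji Di => /vlineP[c ->].
  by rewrite !linearZ /= comul1 tens_eval_tens la1 scale1r [c *: (1 : k^o)]mulr1.
have [coD _ _] := simpD j; have [s /allP hs ->] := coD _ hj.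
rewrite (la0 _ _ ji hj) scale0r raddf_sum big_seq big1 // => p /hs /andP[_ p2].
by rewrite [LHS]tens_eval_tens (la0 _ _ ji p2) scale0r.
Qed.

End Integrals.

(** * Hopf-Galois extensions *)

Section Galois.
Variables (k : fieldType) (H : falgType k) (HH : hopf_algebra H).
Variables (A : algType k) (gA : graded_algebra A).
Variable rho : graded_comodule_algebra HH gA.
Local Notation B := (coinvariants rho).

(** The action of [theta], an element of the dual algebra of H, on A: a |-> a_(0) theta(a_(1)). For
    the integral [la] it is the projection E onto B. *)
Definition coact_eval (theta : {linear H -> k^o}) (a : A) : A := tens_eval theta (rho a).

Lemma coact_eval_linear theta : linear (coact_eval theta).
Proof. by move=> c a b; rewrite /coact_eval !linearP. Qed.

HB.instance Definition _ theta := GRing.isLinear.Build k A A _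
  (coact_eval theta) (coact_eval_linear theta).

Lemma coact_coinv (b : B) : rho (val b) = val b ⊗ 1.
Proof. exact/eqP/(valP b). Qed.

Lemma coact_eval_mull theta (b : B) a :
  coact_eval theta (val b * a) = val b * coact_eval theta a.
Proof. by rewrite /coact_eval coactM coact_coinv tens_eval_mull. Qed.

Lemma coact_eval_mulr theta (b : B) a :
  coact_eval theta (a * val b) = coact_eval theta a * val b.
Proof. by rewrite /coact_eval coactM coact_coinv tens_eval_mulr. Qed.

Lemma coact_eval_comp theta n a :
  gA n (coact_eval theta a) = coact_eval theta (gA n a).
Proof.
rewrite /coact_eval coact_comp [LHS]raddf_tlift [in RHS]raddf_tlift.
by apply: eq_tlift => x h; rewrite /= tens_eval_tens linearZ.
Qed.

Lemma coact_eval_deg theta n a :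
  a \in in_deg gA n -> coact_eval theta a \in in_deg gA n.
Proof. by move=> /homogP ha; apply/homogP; rewrite coact_eval_comp ha. Qed.

Lemma coact_eval_counit a : coact_eval (counit HH) a = a.
Proof. exact: coact_counit. Qed.

(** Coassociativity and the integral property give rho(a_(0)) la(a_(1)) = a_(0) ⊗ a_(1) la(a_(2)) =
    a_(0) la(a_(1)) ⊗ 1. *)
Lemma coact_eval_coinv (la : {linear H -> k^o}) a :
  (forall h, tens_eval la (comul HH h) = (la h : k)%:A) ->
  coact_eval la a \in coinv rho.
Proof.
move=> hla; apply/eqP; rewrite /coact_eval.
pose F (x : A) (w : (H ⊗ H)%type) := x ⊗ tens_eval la w.
have bF : kbalanced F.
  apply: klift_balanced => [w c x y|x c v w]; rewrite /F.
    by rewrite ktensDl ktensZl.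
  by rewrite linearP ktensDr ktensZr.
(* Here id ⊗ id ⊗ [la] is applied to both sides of coassociativity. *)
have := congr1 (tlift F) (coactA rho a); rewrite !(tlift_tlift _ _ bF) => E.
rewrite [LHS]raddf_tlift.
transitivity (tlift (fun x h =>
    tlift F (tlift (fun x0 x1 => x0 ⊗ (x1 ⊗ h)) (rho x))) (rho a)).
  apply: eq_tlift => x h; rewrite /= linearZ /= (tlift_tlift _ _ bF).
  have [s ->] := ktensor_gen (rho x).
  have b1 : kbalanced (fun m n => tlift F (m ⊗ (n ⊗ h))).
    apply: klift_balanced => [n c u v|u c n n'].
      by rewrite !(tlift_tens _ _ bF) /F ktensDl ktensZl.
    rewrite !(tlift_tens _ _ bF) /F !tens_eval_tens.
    by rewrite linearP ktensDr ktensZr.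
  rewrite (tlift_sum _ _ b1) scaler_sumr; apply: eq_bigr => p _.
  by rewrite !(tlift_tens _ _ b1) (tlift_tens _ _ bF) /F tens_eval_tens ktensZr.
rewrite E [tens_eval la _]/tens_eval.
have -> : (tlift (fun a h => (la h : k) *: a) (rho a) ⊗ 1 : (A ⊗ H)%type) =
  tlift (fun a h => ((la h : k) *: a) ⊗ 1) (rho a).
  rewrite /tlift /formal_eval; elim/big_ind2: _ => [|x y z t <- <-|//].
    by rewrite ktens0l.
  by rewrite ktensDl.
apply: eq_tlift => x h.
by rewrite (tlift_tens _ _ bF) /F hla -ktensZl -ktensZr.
Qed.

Lemma canonical_mapE a a' :
  canonical_map (rho := rho) (tens _ _ a a') = tmul (a ⊗ 1) (rho a').
Proof.
rewrite canonical_map_tens /tmul (tlift_tens _ _ (tmul_outer_balanced _)).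
by apply: eq_tlift => x h; rewrite mul1r.
Qed.

Hypothesis gal : galois_graded_extension rho.

(** Injectivity of the canonical map, in a form that handles elements of A ⊗_B A as lists of pairs
    and tests them by balanced maps. *)
Lemma galois_inj (s t : seq (A * A)) :
  \sum_(p <- s) tmul (p.1 ⊗ 1) (rho p.2)
    = \sum_(p <- t) tmul (p.1 ⊗ 1) (rho p.2) ->
  forall (G : zmodType) (f : A -> A -> G),
  @balanced B A A (fun a b => a * val b) (fun b a => val b * a) G f ->
  \sum_(p <- s) f p.1 p.2 = \sum_(p <- t) f p.1 p.2.
Proof.
move=> st G f bf.
pose ev (u : seq (A * A)) : galois_source rho := \sum_(p <- u) tens _ _ p.1 p.2.
have evf u : tlift f (ev u) = \sum_(p <- u) f p.1 p.2.
  by rewrite (tlift_sum _ _ bf); apply: eq_bigr => p _; rewrite (tlift_tens _ _ bf).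
have evc u : canonical_map (rho := rho) (ev u) = \sum_(p <- u) tmul (p.1 ⊗ 1) (rho p.2).
  rewrite [LHS](tlift_sum _ _ (canonical_map_balanced rho)).
  by apply: eq_bigr => p _; rewrite -canonical_mapE.
have ev_st : ev s = ev t by apply: (bij_inj gal); rewrite !evc.
by rewrite -!evf ev_st.
Qed.

(** In a preimage of 1 ⊗ h both factors of every term may be replaced by their degree-zero
    components: the projection [D] of A ⊗ H onto degree 0 is multiplicative, commutes with [rho] and
    fixes 1 ⊗ h. *)
Lemma galois_lift (h : H) :
  exists2 s : seq (A * A),
    forall p, p \in s -> (p.1 \in in_deg gA 0) && (p.2 \in in_deg gA 0)
    & \sum_(p <- s) tmul (p.1 ⊗ 1) (rho p.2) = 1 ⊗ h.
Proof.
have [inv _ invK] := gal; pose x := inv (1 ⊗ h).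
pose D : (A ⊗ H)%type -> (A ⊗ H)%type := tlift (fun a h => gA 0%N a ⊗ h).
have bD : kbalanced (fun (a : A) (h : H) => gA 0%N a ⊗ h).
  apply: klift_balanced => [g c a b|a c g g'].
    by rewrite linearP ktensDl ktensZl.
  by rewrite ktensDr ktensZr.
have DD := tliftD bD; have D0 := tlift0 bD; rewrite -/D in DD D0.
have Dt a g : D (a ⊗ g) = gA 0%N a ⊗ g by exact: (tlift_tens _ _ bD).
have DM y z : D (tmul y z) = tmul (D y) (D z).
  elim/ktensor_ind: y => [|y y' hy hy'|a g]; rewrite ?(tmul0l, D0) ?tmul0l //.
    by rewrite tmulDl !DD hy hy' tmulDl.
  elim/ktensor_ind: z => [|z z' hz hz'|b l]; rewrite ?(tmul0r, D0) ?tmul0r //.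
    by rewrite tmulDr !DD hz hz' tmulDr.
  by rewrite !(Dt, tmul_tens) acomp0M.
exists [seq (gA 0%N p.1, gA 0%N p.2) | p <- repr x].
  by move=> _ /mapP[p _ ->]; rewrite !acomp_homog.
rewrite big_map -[RHS](_ : D (1 ⊗ h) = _); last first.
  by rewrite Dt (homogP _ _ _ (acomp_one gA)).
rewrite -[1 ⊗ h]invK -/x [x in RHS]tensor_gen.
rewrite [canonical_map _](tlift_sum _ _ (canonical_map_balanced rho)).
rewrite [RHS](tlift_sum _ _ bD); apply: eq_bigr => p _ /=.
by rewrite [tlift _ (tens _ _ _ _)]canonical_mapE -/D DM Dt coact_comp.
Qed.

End Galois.

(** * Casimir element and dual basis of a Galois extension *)

Section GaloisConsequences.
Variables (k : fieldType) (H : falgType k) (HH : hopf_algebra H).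
Variables (A : algType k) (gA : graded_algebra A).
Variable rho : graded_comodule_algebra HH gA.
Local Notation B := (coinvariants rho).
Local Notation gB := (coinv_graded rho).
Hypothesis gal : galois_graded_extension rho.

Definition coinv_incl : {rmorphism B -> A} := val.

(** The list represents the preimage of 1 ⊗ t. Its product is eps(t) = 1, since multiplication is
    the canonical map followed by id ⊗ eps. Multiplying it by a on the left or on the right gives
    the same image, as (1 ⊗ t) rho(a) = a_(0) ⊗ t a_(1) = a ⊗ t. *)
Lemma galois_casimir :
  semisimple_ring H ->
  exists s : seq (A * A),
    [/\ forall p, p \in s -> (p.1 \in in_deg gA 0) && (p.2 \in in_deg gA 0),
        \sum_(p <- s) p.1 * p.2 = 1
      & forall (G : zmodType) (f : A -> A -> G),
          @balanced B A A (fun a b => a * val b) (fun b a => val b * a) G f ->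
          forall a, \sum_(p <- s) f (a * p.1) p.2 = \sum_(p <- s) f p.1 (p.2 * a)].
Proof.
move=> ssH; have [t t1 tint] := semisimple_integral HH ssH.
have [s s0 sE] := galois_lift gal t; exists s; split=> //.
  have := congr1 (tens_eval (counit HH)) sE.
  rewrite tens_eval_tens /= t1 scale1r raddf_sum => <-; apply: eq_bigr => p _ /=.
  by rewrite tens_eval_mull -[tens_eval _ _]/(coact_eval rho _ _) coact_eval_counit.
move=> G f bf a.
suff E : \sum_(p <- [seq (a * p.1, p.2) | p <- s]) tmul (p.1 ⊗ 1) (rho p.2)
       = \sum_(p <- [seq (p.1, p.2 * a) | p <- s]) tmul (p.1 ⊗ 1) (rho p.2).
  by have := galois_inj gal E bf; rewrite !big_map.
rewrite !big_map /=.
transitivity (a ⊗ t).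
  transitivity (tmul (a ⊗ 1) (\sum_(p <- s) tmul (p.1 ⊗ 1) (rho p.2))).
    by rewrite tmul_sumr; apply: eq_bigr => p _; rewrite tmulA tmul_tens mulr1.
  by rewrite sE tmul_tens mulr1 mul1r.
transitivity (tmul (\sum_(p <- s) tmul (p.1 ⊗ 1) (rho p.2)) (rho a)); last first.
  by rewrite tmul_suml; apply: eq_bigr => p _; rewrite coactM tmulA.
rewrite sE -[in LHS](coact_eval_counit rho a) /coact_eval.
elim/ktensor_ind: (rho a) => [|x y hx hy|b h].
- by rewrite raddf0 ktens0l tmul0r.
- by rewrite raddfD ktensDl tmulDr hx hy.
by rewrite tens_eval_tens tmul_tens mul1r tint -ktensZl ktensZr.
Qed.

Section DualFunction.
Variables (la theta : {linear H -> k^o}) (c : A).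
Hypothesis la_int : forall h, tens_eval la (comul HH h) = (la h : k)%:A.

(** The function a |-> E(a_(0) theta(a_(1)) c), with E the map given by [la]. *)
Definition dual_fun (a : A) : B :=
  Subalgebra (coact_eval_coinv rho (coact_eval rho theta a * c) la_int).

Lemma dual_fun_additive : zmod_morphism dual_fun.
Proof. by move=> a b; apply: val_inj; rewrite /= raddfB mulrBl raddfB. Qed.

HB.instance Definition _ :=
  GRing.isZmodMorphism.Build A B dual_fun dual_fun_additive.

Lemma dual_funM (b : B) a : dual_fun (coinv_incl b * a) = b * dual_fun a.
Proof. by apply: val_inj; rewrite /= coact_eval_mull -mulrA coact_eval_mull. Qed.

Lemma dual_fun_deg n a :
  c \in in_deg gA 0 -> a \in in_deg gA n -> dual_fun a \in in_deg gB n.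
Proof.
move=> c0 ha; rewrite [_ \in _]coinv_homog /=; apply: coact_eval_deg.
by rewrite -[n]addn0; apply: acomp_mul c0; apply: coact_eval_deg.
Qed.

End DualFunction.

Lemma galois_dual_basis :
  cosemisimple HH ->
  exists (I : finType) (f : I -> {additive A -> B}) (r : I -> A),
    [/\ forall j b a, f j (coinv_incl b * a) = b * f j a,
        forall j n a, a \in in_deg gA n -> f j a \in in_deg gB n,
        forall j, r j \in in_deg gA 0
      & forall a, a = \sum_j coinv_incl (f j a) * r j].
Proof.
move=> csH; have [la la1 la_int] := cosemisimple_integral csH.
pose X := vbasis (fullv : {vspace H}); pose n := \dim (fullv : {vspace H}).
pose co (i : 'I_n) : {linear H -> k^o} := coord X i.
have /fin_all_exists2[s s0 sE] (i : 'I_n) := galois_lift gal X`_i.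
(* An index is a basis vector x_i of H together with a term l ⊗ r of the lift of 1 ⊗ x_i; the bound
   on the second component keeps [nth] off its default. *)
pose I := {i : 'I_n & 'I_(size (s i))}.
pose q (j : I) := nth (0, 0) (s (tag j)) (tagged j).
have q0 j : ((q j).1 \in in_deg gA 0) && ((q j).2 \in in_deg gA 0).
  by apply: s0; apply: mem_nth.
exists I, (fun j => dual_fun (co (tag j)) (q j).1 la_int), (fun j => (q j).2); split.
- by move=> j b a; apply: dual_funM.
- by move=> j m a; apply: dual_fun_deg; have /andP[] := q0 j.
- by move=> j; have /andP[] := q0 j.
move=> a.
pose t := flatten
  [seq [seq (coact_eval rho (co i) a * p.1, p.2) | p <- s i] | i <- enum 'I_n].
(* The map x ⊗ y |-> E(x) y is balanced because E is right B-linear. *)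
pose F (x y : A) := coact_eval rho la x * y.
have bF : @balanced B A A (fun a b => a * val b) (fun b a => val b * a) A F.
  split=> [x y z|x y z|x b y]; rewrite /F.
  - by rewrite raddfD mulrDl.
  - by rewrite mulrDr.
  - by rewrite coact_eval_mulr mulrA.
have expand (z : (A ⊗ H)%type) : z = \sum_i tens_eval (co i) z ⊗ X`_i.
  elim/ktensor_ind: z => [|x y hx hy|b h].
  - by rewrite big1 // => i _; rewrite raddf0 ktens0l.
  - rewrite {1}hx {1}hy -big_split; apply: eq_bigr => i _ /=.
    by rewrite raddfD ktensDl.
  rewrite {1}(coord_vbasis (memvf h)) -/X.
  transitivity (\sum_i b ⊗ (co i h *: X`_i)).
    apply: (big_morph (ktens b)) => [g g'|]; first exact: ktensDr.
    by rewrite -[X in b ⊗ X](scale0r 1) -ktensZr scale0r.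
  by apply: eq_bigr => i _; rewrite tens_eval_tens -ktensZr ktensZl.
(* Both sides of the identity 1 ⊗_B a = sum phi_i(a) l(x_i) ⊗_B r(x_i) have
   image rho(a) under the canonical map, phi_i(a) being the coordinates of
   rho(a) in the basis x_i of H. *)
have E : \sum_(p <- [:: (1, a)]) tmul (p.1 ⊗ 1) (rho p.2)
       = \sum_(p <- t) tmul (p.1 ⊗ 1) (rho p.2).
  rewrite big_seq1 /= -[1 ⊗ 1](coact1 rho) -coactM mul1r [LHS]expand.
  rewrite big_flatten big_map big_enum; apply: eq_bigr => i _ /=.
  rewrite big_map /= -/(coact_eval _ _ _).
  transitivity (tmul (coact_eval rho (co i) a ⊗ 1) (1 ⊗ X`_i)).
    by rewrite tmul_tens mulr1 mul1r.
  by rewrite -sE tmul_sumr; apply: eq_bigr => p _; rewrite tmulA tmul_tens mulr1.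
have := galois_inj gal E bF.
(* As E(1) = la(1) = 1, the value of [F] at 1 ⊗ a is a itself. *)
rewrite big_seq1 /= /F /coact_eval coact1 tens_eval_tens la1 scale1r mul1r.
move=> {}E; rewrite [LHS]E.
rewrite /t big_flatten big_map big_enum /=.
transitivity (\sum_i \sum_(j < size (s i))
    F (coact_eval rho (co i) a * (nth (0, 0) (s i) j).1) (nth (0, 0) (s i) j).2).
  by apply: eq_bigr => i _; rewrite big_map (big_nth (0, 0)) big_mkord.
by rewrite sig_big_dep /=; apply: eq_bigr.
Qed.

End GaloisConsequences.

(** * Semisimplicity of the degree-zero part *)

Section GaloisSemisimple.
Variables (k : fieldType) (H : falgType k) (HH : hopf_algebra H).
Variables (A : algType k) (gA : graded_algebra A).
Variable rho : graded_comodule_algebra HH gA.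
Local Notation B := (coinvariants rho).
Local Notation gB := (coinv_graded rho).

Lemma coinv_incl_deg n (b : B) :
  b \in in_deg gB n -> coinv_incl rho b \in in_deg gA n.
Proof. by rewrite [_ \in _]coinv_homog. Qed.

Lemma coinv_incl0_subproof (b : degree_zero gB) :
  coinv_incl rho (val b) \in deg0 gA.
Proof. exact: coinv_incl_deg (valP b). Qed.

Definition coinv_incl0 (b : degree_zero gB) : degree_zero gA :=
  Subalgebra (coinv_incl0_subproof b).

Lemma coinv_incl0_zmod : zmod_morphism coinv_incl0.
Proof. by move=> x y; apply: val_inj. Qed.

Lemma coinv_incl0_monoid : monoid_morphism coinv_incl0.
Proof. by split=> [|x y]; apply: val_inj. Qed.

HB.instance Definition _ := GRing.isZmodMorphism.Build
  (degree_zero gB) (degree_zero gA) coinv_incl0 coinv_incl0_zmod.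
HB.instance Definition _ := GRing.isMonoidMorphism.Build
  (degree_zero gB) (degree_zero gA) coinv_incl0 coinv_incl0_monoid.

Definition deg0_proj (a : A) : degree_zero gA :=
  @Subalgebra _ _ (deg0 gA) _ (acomp_homog gA 0 a).

Lemma deg0_projD a b : deg0_proj (a + b) = deg0_proj a + deg0_proj b.
Proof. by apply: val_inj; rewrite /= raddfD. Qed.

Lemma deg0_projM a b : deg0_proj (a * b) = deg0_proj a * deg0_proj b.
Proof. by apply: val_inj; rewrite /= acomp0M. Qed.

Lemma deg0_projK (x : degree_zero gA) : deg0_proj (val x) = x.
Proof. exact/val_inj/homogP/(valP x). Qed.

(** A finite family spanning A_0 over k generates it over B_0, and the Casimir element of A over B
    projects to a separability element of A_0 over B_0. *)
Lemma galois_semisimple :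
  galois_graded_extension rho -> semisimple_ring H ->
  finite_dim_component gA 0 ->
  semisimple_ring (degree_zero gB) -> semisimple_ring (degree_zero gA).
Proof.
move=> gal ssH [n [e [e0 egen]]].
have [s [s0 s1 sC]] := galois_casimir gal ssH.
apply: (semisimple_extension (i := coinv_incl0)
  (g := fun l : 'I_n => (@Subalgebra _ _ (deg0 gA) _ (e0 l) : degree_zero gA))
  (xs := [seq (deg0_proj p.1, deg0_proj p.2) | p <- s])).
- move=> x; have [c xE] := egen _ (valP x).
  exists (fun l => (c l)%:A); apply: val_inj; rewrite raddf_sum /= xE.
  by apply: eq_bigr => l _; rewrite -[RHS]scalerAr mulr1.
- rewrite big_map; transitivity (deg0_proj 1); last exact: (deg0_projK 1).
  rewrite -s1.
  rewrite (big_morph deg0_proj deg0_projD (deg0_projK 0)).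
  by apply: eq_bigr => p _; rewrite deg0_projM.
move=> f [fl fr fm] a; rewrite !big_map /=.
(* Composing with the projection onto A_0 turns a B_0-balanced map on A_0 into a B-balanced map on
   A, each b acting through its degree-zero component. *)
pose F x y := f (deg0_proj x) (deg0_proj y).
have -> : \sum_(p <- s) f (a * deg0_proj p.1) (deg0_proj p.2)
        = \sum_(p <- s) F (val a * p.1) p.2.
  by apply: eq_bigr => p _; rewrite /F deg0_projM deg0_projK.
rewrite sC.
  by apply: eq_bigr => p _; rewrite /F deg0_projM deg0_projK.
split=> [x y z|x y z|x b y]; rewrite /F ?deg0_projD ?deg0_projM //.
have <- : coinv_incl0 (@Subalgebra _ _ (deg0 gB) _ (acomp_homog gB 0 b))
        = deg0_proj (val b) by apply: val_inj.
exact: fm.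
Qed.

End GaloisSemisimple.

Theorem theorem2p11 (k : fieldType) (H : falgType k) (HH : hopf_algebra H)
  (A : algType k) (gA : graded_algebra A)
  (rho : graded_comodule_algebra HH gA) (N : nat) :
  semisimple_ring H ->
  cosemisimple HH ->
  (forall i : nat, finite_dim_component gA i) ->
  galois_graded_extension rho ->
  (2 <= N)%N ->
  N_koszul_algebra (coinv_graded rho) N ->
  N_koszul_algebra gA N.
Proof.
move=> ssH csH fd gal _ [_ ssB Bgen Bkoszul].
have [I [f [r [fM f_deg r_deg dual]]]] := galois_dual_basis gal csH.
split=> //; first exact: galois_semisimple gal ssH (fd 0%N) ssB.
(* Each f_l(a) lies in B_(i+j) = B_i B_j, and in f_l(a) r_l the degree-zero factor r_l is absorbed
   into the factor from B_j. *)
- move=> i j a /f_deg fa.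
  have /fin_all_exists2[s sij sE] l := Bgen i j _ (fa l).
  exists (flatten [seq [seq (val p.1, val p.2 * r l) | p <- s l] | l <- enum I]).
    apply/allP => _ /flatten_mapP[l _ /mapP[p /(allP (sij l))/andP[p1 p2] ->]] /=.
    rewrite (coinv_incl_deg p1) -[j]addn0; apply: acomp_mul (r_deg l).
    exact: coinv_incl_deg p2.
  rewrite {1}[a]dual big_flatten big_map big_enum; apply: eq_bigr => l _.
  rewrite sE rmorph_sum mulr_suml big_map; apply: eq_bigr => p _.
  by rewrite mulrA.
exact: trivial_koszul (@coinv_incl_deg _ _ _ _ _ rho) _ _ _ fM f_deg r_deg dual _ Bkoszul.
Qed.
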